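(* For $f,h\in C^\infty(\mathfrak M)_{\mathrm{red}}$, the first reduced Poisson bracket is given, with all derivatives at $(e^q,J)$, by $$\{f,h\}_1^{\mathrm{red}}(e^q,J)=\langle\nabla_1f,(d_2h)^-_0\rangle-\langle\nabla_1h,(d_2f)^-_0\rangle+\langle R(q)[d_2f,J]^+,(d_2h)^-\rangle-\langle R(q)[d_2h,J]^+,(d_2f)^-\rangle+\langle J^+,[(d_2f)^-,(d_2h)^-]-[(d_2f)^+,(d_2h)^+]\rangle .$$ If $h$ is the restriction $H\circ\iota$ of any of the functions $H_k(g,J)=\frac1k\Re\operatorname{tr}(J^k)$ or $\tilde H_k(g,J)=\frac1k\Im\operatorname{tr}(J^k)$ ($k\ge1$), this can be written as $$\{f,h\}_1^{\mathrm{red}}(e^q,J)=\langle\nabla_1f,(d_2h)^-_0\rangle+\langle d_2f,[R(q)(d_2h)^--(d_2h)^+,J]\rangle .$$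
   Context: $G=\mathrm{GL}(n,\mathbb C)$ (real Lie group), $\mathcal G=\mathfrak{gl}(n,\mathbb C)$ (real Lie algebra) with $\langle X,Y\rangle=\Re\operatorname{tr}(XY)$. $\mathcal G^+=\mathfrak u(n)$ (anti-Hermitian), $\mathcal G^-=\mathrm i\,\mathfrak u(n)$ (Hermitian); $X=X^++X^-$ with $X^\pm=\frac12(X\mp X^* )$; $\mathcal G^\pm_0$ are the diagonal matrices in $\mathcal G^\pm$, and $X^-_0$ is the diagonal part of $X^-$. $\mathfrak M=G\times\mathcal G=\{(g,J)\}$. For $F\in C^\infty(\mathfrak M,\mathbb R)$: $\langle\nabla_1F,X\rangle=\frac{d}{dt}|_0F(e^{tX}g,J)$, $\langle d_2F,X\rangle=\frac{d}{dt}|_0F(g,J+tX)$ for $X\in\mathcal G$. The first Poisson bracket on $\mathfrak M$ is $\{F,H\}_1=\langle \nabla_1F,d_2H\rangle-\langle\nabla_1H,d_2F\rangle+\langle J,[d_2F,d_2H]\rangle$. For $\eta\in\mathrm U(n)$, $\mathcal R_\eta(g,J)=(g\eta^{-1},J)$, $\mathcal L_\eta(g,J)=(\eta g,\eta J\eta^{-1})$; $C^\infty(\mathfrak M)^{\mathrm U(n)\times\mathrm U(n)}$ is the set of smooth real functions invariant under all these maps (it is closed under $\{\ ,\ \}_1$). Let $\mathfrak M_0^{\mathrm{reg}}=\{(e^q,J): J\in\mathcal G,\ q=\mathrm{diag}(q_1,\dots,q_n)\in\mathcal G^-_0,\ q_1>\dots>q_n\}$ with inclusion $\iota:\mathfrak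 M_0^{\mathrm{reg}}\to\mathfrak M$, and $C^\infty(\mathfrak M)_{\mathrm{red}}=\{F\circ\iota: F\in C^\infty(\mathfrak M)^{\mathrm U(n)\times\mathrm U(n)}\}$. The reduced bracket is $\{F\circ\iota,H\circ\iota\}_1^{\mathrm{red}}=\{F,H\}_1\circ\iota$. For $f\in C^\infty(\mathfrak M_0^{\mathrm{reg}})$: $\nabla_1f\in\mathcal G^-_0$ with $\langle\nabla_1f,X_0\rangle=\frac{d}{dt}|_0f(e^{q+tX_0},J)$ for $X_0\in\mathcal G_0^-$, and $d_2f\in\mathcal G$ with $\langle d_2f,X\rangle=\frac{d}{dt}|_0f(e^q,J+tX)$. $R(q)\in\mathrm{End}(\mathcal G)$: $(R(q)X)_{ii}=0$, $(R(q)X)_{ij}=X_{ij}\coth(q_i-q_j)$ for $i\ne j$. *)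

(* Defs.v *)
From HB Require Import structures.
From mathcomp Require Import all_boot all_order all_algebra.
From mathcomp Require Import all_classical all_reals all_analysis.
From mathcomp Require Import complex.

Set Implicit Arguments.
Unset Strict Implicit.
Unset Printing Implicit Defensive.

Import Order.TTheory GRing.Theory Num.Theory.
Import numFieldTopology.Exports numFieldNormedType.Exports.

Local Open Scope classical_set_scope.
Local Open Scope ring_scope.
Local Open Scope complex_scope.

(* The (metric) topology of C = R[i] given by its absolute value; the
   generic instance of mathcomp-analysis for numFieldTypes is not found by
   unification on the concrete type R[i], so we declare it. Matrices
   'M[R[i]]_(m,n) then carry the usual (max-norm) topology. *)
HB.instance Definition _ (R : rcfType) := PseudoPointedMetric.copy R[i] R[i]^o.

Section GLnC.
Variables (R : realType) (n : nat).

Local Notation Mx := 'M[R[i]]_n.+1.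

Definition reC (z : R[i]) : R := complex.Re z.
Definition imC (z : R[i]) : R := complex.Im z.

Definition ip (X Y : Mx) : R := reC (\tr (X *m Y)).

Definition adjm (X : Mx) : Mx := (map_mx (@conjc R) X)^T.

Definition pplus (X : Mx) : Mx := (2%:R : R[i])^-1 *: (X - adjm X).
Definition pminus (X : Mx) : Mx := (2%:R : R[i])^-1 *: (X + adjm X).

Definition diagpart (X : Mx) : Mx := \matrix_(i, j) if i == j then X i j else 0.
Definition pminus0 (X : Mx) : Mx := diagpart (pminus X).

Definition lie (X Y : Mx) : Mx := X *m Y - Y *m X.

Definition rscal (t : R) (X : Mx) : Mx := (t%:C) *: X.

Definition expm (X : Mx) : Mx := limn (series (fun k => (k`!%:R : R[i])^-1 *: X ^+ k)).

Definition G0minus (X : Mx) : Prop :=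
  (forall i j, i != j -> X i j = 0) /\ (forall i, imC (X i i) = 0).

Definition regular (q : Mx) : Prop :=
  G0minus q /\ (forall i j : 'I_n.+1, (i < j)%N -> reC (q j j) < reC (q i i)).

Definition coth (x : R) : R := (expR x + expR (- x)) / (expR x - expR (- x)).

Definition Rq (q X : Mx) : Mx :=
  \matrix_(i, j) if i == j then 0 else (coth (reC (q i i) - reC (q j j)))%:C * X i j.

Definition unitary (eta : Mx) : Prop := eta *m adjm eta = 1%:M.

(* functions on M = G x gl(n,C) are represented by total functions
   F : Mx -> Mx -> R, F g J, of which only the values at g \in unitmx matter *)

Definition UUinvariant (F : Mx -> Mx -> R) : Prop :=
  forall eta g J, unitary eta -> g \in unitmx ->
    F (g *m invmx eta) J = F g J /\ F (eta *m g) (eta *m J *m invmx eta) = F g J.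

Fixpoint dirders (F : Mx -> Mx -> R) (vs : seq (Mx * Mx)) : Mx -> Mx -> R :=
  match vs with
  | [::] => F
  | v :: vs' => fun g J =>
      derive1 (fun t : R => dirders F vs' (g + rscal t v.1) (J + rscal t v.2)) 0
  end.

(* F in C^oo(M,R), M = G x gl(n,C) open in the real vector space
   gl(n,C) x gl(n,C): all iterated directional derivatives exist on M and
   are continuous on M *)
Definition smooth_on_M (F : Mx -> Mx -> R) : Prop :=
  forall vs : seq (Mx * Mx),
    (forall v g J, g \in unitmx ->
       derivable (fun t : R => dirders F vs (g + rscal t v.1) (J + rscal t v.2)) 0 1)
    /\ (forall g J, g \in unitmx ->
       {for (g, J), continuous (fun p : Mx * Mx => dirders F vs p.1 p.2)}).

Definition is_nabla1 (F : Mx -> Mx -> R) (g J Y : Mx) : Prop :=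
  forall X, is_derive (0 : R) (1 : R)
              (fun t : R => F (expm (rscal t X) *m g) J) (ip Y X).

Definition is_d2 (F : Mx -> Mx -> R) (g J Y : Mx) : Prop :=
  forall X, is_derive (0 : R) (1 : R) (fun t : R => F g (J + rscal t X)) (ip Y X).

(* reduced function f = F o iota on M_0^reg, as a function of the point (e^q, J) *)
Definition restr (F : Mx -> Mx -> R) (q J : Mx) : R := F (expm q) J.

Definition is_nabla1_red (f : Mx -> Mx -> R) (q J Y : Mx) : Prop :=
  G0minus Y /\
  forall X0, G0minus X0 ->
    is_derive (0 : R) (1 : R) (fun t : R => f (q + rscal t X0) J) (ip Y X0).

Definition is_d2_red (f : Mx -> Mx -> R) (q J Y : Mx) : Prop :=
  forall X, is_derive (0 : R) (1 : R) (fun t : R => f q (J + rscal t X)) (ip Y X).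

Definition bracket1 (J nF dF nH dH : Mx) : R :=
  ip nF dH - ip nH dF + ip J (lie dF dH).

Definition Hk (k : nat) (g J : Mx) : R := (k%:R)^-1 * reC (\tr (J ^+ k)).
Definition tHk (k : nat) (g J : Mx) : R := (k%:R)^-1 * imC (\tr (J ^+ k)).

End GLnC.

(* Main.v *)
(* The gradient N of F at (e^q, J) is determined by three facts. Right invariance
   makes e^(-q) N e^q Hermitian, which off the diagonal expresses the Hermitian part of
   N through its anti-Hermitian part P by the factors coth (q_i - q_j). Left invariance
   gives P = [d_2 F, J]^+. Varying q along the diagonal identifies the remaining real
   diagonal with the reduced gradient, so N = P + R(q) P + nabla_1 f. Substituting
   this in the unreduced bracket leaves an identity of invariant forms. The functions
   H_k, ~H_k do not depend on g and are conjugation invariant, so their unreduced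
   nabla_1 vanishes and their d_2 commutes with J.
   Smoothness is only used through a local Lipschitz bound: F has the same derivative
   along two curves that agree up to O(t^2). *)

Require Import Defs.
From HB Require Import structures.
From mathcomp Require Import all_boot all_order all_algebra.
From mathcomp Require Import all_classical all_reals all_analysis.
From mathcomp Require Import complex ring lra.

Import Order.TTheory GRing.Theory Num.Theory.
Import numFieldTopology.Exports numFieldNormedType.Exports.

Local Open Scope classical_set_scope.
Local Open Scope ring_scope.

Set Implicit Arguments.
Unset Strict Implicit.
Unset Printing Implicit Defensive.

(** * A submultiplicative real norm on complex matrices *)

Section L1norm.
Variable R : realType.
Implicit Types z w : R[i].

(** The modulus of [R[i]] takes its values in [R[i]], whereas the estimates for the real-valued F
    need a norm in [R]. The l1 choice avoids square roots and adds up exactly over real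
    coordinates. *)
Definition norm1c z : R := `|reC z| + `|imC z|.

Lemma reD z w : reC (z + w) = reC z + reC w. Proof. by case: z w => [? ?] []. Qed.
Lemma imD z w : imC (z + w) = imC z + imC w. Proof. by case: z w => [? ?] []. Qed.
Lemma reN z : reC (- z) = - reC z. Proof. by case: z. Qed.
Lemma imN z : imC (- z) = - imC z. Proof. by case: z. Qed.
Lemma reM z w : reC (z * w) = reC z * reC w - imC z * imC w.
Proof. by case: z w => [? ?] []. Qed.
Lemma imM z w : imC (z * w) = reC z * imC w + imC z * reC w.
Proof. by case: z w => [? ?] []. Qed.

Lemma re_sum (I : Type) (r : seq I) (P : pred I) (f : I -> R[i]) :
  reC (\sum_(i <- r | P i) f i) = \sum_(i <- r | P i) reC (f i).
Proof. exact: (big_morph _ reD). Qed.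
Lemma im_sum (I : Type) (r : seq I) (P : pred I) (f : I -> R[i]) :
  imC (\sum_(i <- r | P i) f i) = \sum_(i <- r | P i) imC (f i).
Proof. exact: (big_morph _ imD). Qed.

Lemma complex_eqP z w : reC z = reC w -> imC z = imC w -> z = w.
Proof. by case: z w => [? ?] [? ?]; rewrite /reC /imC /= => -> ->. Qed.

Lemma norm1c_ge0 z : 0 <= norm1c z.
Proof. by rewrite addr_ge0. Qed.

Lemma norm1c0 : norm1c 0 = 0.
Proof. by rewrite /norm1c normr0 addr0. Qed.

Lemma norm1c_eq0 z : norm1c z = 0 -> z = 0.
Proof.
move/eqP; rewrite paddr_eq0 // !normr_eq0 => /andP[/eqP a /eqP b].
exact: complex_eqP.
Qed.

Lemma norm1cD z w : norm1c (z + w) <= norm1c z + norm1c w.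
Proof. by rewrite /norm1c reD imD addrACA lerD // ler_normD. Qed.

Lemma norm1cM z w : norm1c (z * w) <= norm1c z * norm1c w.
Proof.
rewrite /norm1c reM imM mulrDl !mulrDr -!normrM.
apply: le_trans (lerD (ler_normB _ _) (ler_normD _ _)) _; lra.
Qed.

Lemma norm1c_re z : `|reC z| <= norm1c z.
Proof. by rewrite lerDl. Qed.

Lemma norm1c_im z : `|imC z| <= norm1c z.
Proof. by rewrite lerDr. Qed.

Lemma norm1cZ (x : R) z : norm1c (x%:C%C * z) = `|x| * norm1c z.
Proof.
by rewrite /norm1c reM imM /= !mul0r subr0 addr0 !normrM mulrDr.
Qed.

Lemma normc_le_norm1c z : `|z| <= (norm1c z)%:C%C.
Proof.
rewrite normc_def lecR -(ger0_norm (norm1c_ge0 z)) -sqrtr_sqr ler_wsqrtr //.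
rewrite /norm1c sqrrD !real_normK ?num_real // /reC /imC addrAC lerDl.
by rewrite mulrn_wge0 // mulr_ge0.
Qed.

(** Unlike the max norm behind the matrix topology, this norm is submultiplicative. The identity has
    norm n+1 and not 1, hence the factors [norm1 1%:M] in later bounds. *)
Definition norm1 (m n : nat) (X : 'M[R[i]]_(m, n)) : R :=
  \sum_i \sum_j norm1c (X i j).

Lemma norm1_ge0 m n (X : 'M[R[i]]_(m, n)) : 0 <= norm1 X.
Proof. by apply: sumr_ge0 => i _; apply: sumr_ge0 => j _; exact: norm1c_ge0. Qed.

Lemma norm1c_le_norm1 m n (X : 'M[R[i]]_(m, n)) i j : norm1c (X i j) <= norm1 X.
Proof.
rewrite /norm1 (bigD1 i) //= (bigD1 j) //= -addrA lerDl addr_ge0 //.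
  by apply: sumr_ge0 => k _; exact: norm1c_ge0.
by apply: sumr_ge0 => k _; apply: sumr_ge0 => l _; exact: norm1c_ge0.
Qed.

Lemma norm1_le m n (X : 'M[R[i]]_(m, n)) (b : R) :
  (forall i j, norm1c (X i j) <= b) -> norm1 X <= m%:R * n%:R * b.
Proof.
move=> h; apply: (@le_trans _ _ (\sum_(i < m) (\sum_(j < n) b))).
  by do 2!(apply: ler_sum => ? _); exact: h.
by rewrite !sumr_const !card_ord -mulrnA mulnC -natrM mulr_natl.
Qed.

Lemma norm10 m n : norm1 (0 : 'M[R[i]]_(m, n)) = 0.
Proof. by rewrite /norm1 big1 // => i _; rewrite big1 // => j _; rewrite mxE norm1c0. Qed.

Lemma norm1_eq0 m n (X : 'M[R[i]]_(m, n)) : norm1 X = 0 -> X = 0.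
Proof.
move=> h; apply/matrixP => i j; rewrite mxE; apply: norm1c_eq0; apply/eqP.
by rewrite eq_le norm1c_ge0 andbT -h norm1c_le_norm1.
Qed.

Lemma norm1D m n (X Y : 'M[R[i]]_(m, n)) : norm1 (X + Y) <= norm1 X + norm1 Y.
Proof.
rewrite /norm1 -big_split; apply: ler_sum => i _ /=.
by rewrite -big_split; apply: ler_sum => j _ /=; rewrite mxE norm1cD.
Qed.

Lemma norm1N m n (X : 'M[R[i]]_(m, n)) : norm1 (- X) = norm1 X.
Proof.
apply: eq_bigr => i _; apply: eq_bigr => j _.
by rewrite mxE /norm1c reN imN !normrN.
Qed.

Lemma norm1B m n (X Y : 'M[R[i]]_(m, n)) : norm1 (X - Y) <= norm1 X + norm1 Y.
Proof. by rewrite (le_trans (norm1D _ _)) // norm1N. Qed.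

Lemma norm1M m n p (X : 'M[R[i]]_(m, n)) (Y : 'M[R[i]]_(n, p)) :
  norm1 (X *m Y) <= norm1 X * norm1 Y.
Proof.
rewrite /norm1 mulr_suml; apply: ler_sum => i _.
apply: (@le_trans _ _ (\sum_k \sum_j (norm1c (X i j) * norm1c (Y j k)))).
  apply: ler_sum => k _; rewrite mxE.
  elim/big_ind2: _ => [|x1 x2 y1 y2 h1 h2|j _]; rewrite ?norm1c0 //; last exact: norm1cM.
  exact: le_trans (norm1cD _ _) (lerD h1 h2).
rewrite exchange_big mulr_suml; apply: ler_sum => j _ /=.
rewrite -mulr_sumr ler_wpM2l ?norm1c_ge0 //.
rewrite [leRHS](bigD1 j) //= lerDl.
by apply: sumr_ge0 => l _; apply: sumr_ge0 => k _; exact: norm1c_ge0.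
Qed.

Lemma rscalD n (a b : R) (X : 'M[R[i]]_n.+1) : rscal (a + b) X = rscal a X + rscal b X.
Proof. by rewrite /rscal rmorphD scalerDl. Qed.

Lemma rscalM n (a b : R) (X : 'M[R[i]]_n.+1) : rscal (a * b) X = rscal a (rscal b X).
Proof. by rewrite /rscal rmorphM scalerA. Qed.

Lemma rscalDr n (a : R) (X Y : 'M[R[i]]_n.+1) : rscal a (X + Y) = rscal a X + rscal a Y.
Proof. exact: scalerDr. Qed.

Lemma rscal1 n (X : 'M[R[i]]_n.+1) : rscal 1 X = X.
Proof. exact: scale1r. Qed.

Lemma norm1_rscal n (t : R) (X : 'M[R[i]]_n.+1) : norm1 (rscal t X) = `|t| * norm1 X.
Proof.
rewrite /norm1 mulr_sumr; apply: eq_bigr => i _; rewrite mulr_sumr.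
by apply: eq_bigr => j _; rewrite mxE norm1cZ.
Qed.

Lemma norm1X n (X : 'M[R[i]]_n.+1) k :
  norm1 (X ^+ k) <= norm1 (1%:M : 'M[R[i]]_n.+1) * norm1 X ^+ k.
Proof.
elim: k => [|k ih]; first by rewrite !expr0 mulr1.
rewrite exprSr exprSr mulrA; apply: le_trans (norm1M _ _) _.
by rewrite ler_wpM2r // norm1_ge0.
Qed.

(* Neumann's argument: a kernel vector v satisfies v = - v B, so |v| <= |v| |B|. *)
Lemma unitmx_1D n (B : 'M[R[i]]_n.+1) : norm1 B < 1 -> 1%:M + B \in unitmx.
Proof.
move=> hB; rewrite -row_free_unit -kermx_eq0; apply/eqP.
have hk : kermx (1%:M + B) *m (1%:M + B) = 0 by apply/sub_kermxP.
move: (kermx _) hk => K; rewrite mulmxDr mulmx1 => /eqP.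
rewrite addr_eq0 => /eqP hK; apply: norm1_eq0; apply/eqP.
rewrite eq_le norm1_ge0 andbT leNgt; apply/negP => K0.
have := norm1M K B; rewrite -norm1N -hK -{1}[norm1 K]mulr1.
by rewrite ler_pM2l // leNgt hB.
Qed.

(** Quantitative openness of GL(n), from the factorization h = g (1 + g^-1 (h - g)). *)
Lemma unitmx_near n (g h : 'M[R[i]]_n.+1) :
  g \in unitmx -> norm1 (invmx g) * norm1 (h - g) < 1 -> h \in unitmx.
Proof.
move=> gu hlt.
have -> : h = g *m (1%:M + invmx g *m (h - g)).
  by rewrite mulmxDr mulmx1 mulmxA mulmxV // mul1mx addrC subrK.
rewrite unitmx_mul gu /= unitmx_1D // (le_lt_trans _ hlt) //; exact: norm1M.
Qed.

End L1norm.

(** * The matrix exponential *)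

Section RealExpSeries.
Variables (R : realType) (a : nat -> R) (c M : R).
Hypotheses (M0 : 0 <= M) (ha : forall k, `|a k| <= c * M ^+ k).

Let u : nat -> R := fun k => k`!%:R^-1 * a k.

Let c0 : 0 <= c.
Proof. by have := ha 0%N; rewrite expr0 mulr1; apply: le_trans. Qed.

Let u_le k : `|u k| <= c * exp_coeff M k.
Proof.
rewrite /u normrM ger0_norm // [leRHS](_ : _ = k`!%:R^-1 * (c * M ^+ k)).
  by rewrite ler_wpM2l.
by rewrite /exp_coeff /= mulrC mulrA [RHS]mulrC mulrA; ring.
Qed.

Lemma is_cvg_exp_series : cvgn (series (fun k => k`!%:R^-1 * a k)).
Proof.
apply: normed_cvg; apply: series_le_cvg u_le _ => [k|k|].
- exact: normr_ge0.
- by rewrite mulr_ge0 // exp_coeff_ge0.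
- exact: is_cvg_seriesZ (is_cvg_series_exp_coeff M).
Qed.

(** After shifting the index by two, 1/(k+2)! <= 1/k! dominates the tail by c M^2 times the
    exponential series of M. With a k an entry of X^k (real or imaginary part) and M = |X|, this is
    the second-order remainder of exp. *)
Lemma exp_series_tail :
  `|limn (series (fun k => k`!%:R^-1 * a k)) - (a 0%N + a 1%N)| <= c * M ^+ 2 * expR M.
Proof.
have h2 : ([sequence series u (k + 2)%N]_k @ \oo --> limn (series u))%classic.
  by rewrite cvg_shiftn; exact: is_cvg_exp_series.
apply: (@ler_cvg_to _ (nbhs \oo) _ _
  (fun m => `|series u (m + 2)%N - (a 0%N + a 1%N)|)
  (fun m => c * M ^+ 2 * series (exp_coeff M) m)).
- by apply: cvg_norm; apply: cvgB h2 _; exact: cvg_cst.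
- by apply: cvgMr; exact: is_cvg_series_exp_coeff.
apply: nearW => m; elim: m {h2} => [|m ih].
  rewrite add0n /series /= big_nat_recr //= big_nat1 /u !fact0 !invr1 !mul1r.
  by rewrite subrr normr0 big_geq // mulr0.
rewrite addSn !seriesSr mulrDr addrAC; apply: le_trans (ler_normD _ _) _.
rewrite lerD // (le_trans (u_le _)) // /exp_coeff /= addn2.
rewrite (_ : c * M ^+ 2 * _ = c * (M ^+ m.+2 / m`!%:R)); last by rewrite !exprS; ring.
rewrite !ler_wpM2l ?exprn_ge0 //.
rewrite lef_pV2 ?posrE ?ltr0n ?fact_gt0 // ler_nat.
by rewrite !factS mulnA leq_pmull // muln_gt0.
Qed.
End RealExpSeries.

Section MatrixExp.
Variables (R : realType) (n : nat).
Local Notation Mx := 'M[R[i]]_n.+1.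

Lemma reC_invnat (k : nat) (z : R[i]) : reC ((k%:R)^-1 * z) = k%:R^-1 * reC z.
Proof.
have -> : (k%:R : R[i])^-1 = ((k%:R : R)^-1)%:C%C by rewrite fmorphV /= rmorph_nat.
by rewrite reM /= mul0r subr0.
Qed.

Lemma imC_invnat (k : nat) (z : R[i]) : imC ((k%:R)^-1 * z) = k%:R^-1 * imC z.
Proof.
have -> : (k%:R : R[i])^-1 = ((k%:R : R)^-1)%:C%C by rewrite fmorphV /= rmorph_nat.
by rewrite imM /= mul0r addr0.
Qed.

Lemma cvg_complex (u : nat -> R[i]) (l : R[i]) :
  @reC R \o u @ \oo --> reC l -> @imC R \o u @ \oo --> imC l -> u @ \oo --> l.
Proof.
move=> hr hi; apply/(@cvgrPdist_lt _ R[i]^o nat \oo _ u l) => /= e e0.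
(* The order of [R[i]] compares only numbers with equal imaginary parts, so a positive e is real. *)
have ee : e = (reC e)%:C%C by case: e e0 => x y; rewrite ltcE /= => /andP[/eqP -> _].
have re0 : 0 < reC e / 2 by rewrite divr_gt0 //; move: e0; rewrite ee ltcR.
near=> k; apply: le_lt_trans (normc_le_norm1c _) _.
rewrite ee ltcR /norm1c reD imD reN imN (splitr (reC e)) ltrD //.
  by near: k; move/cvgrPdist_lt : hr; apply.
by near: k; move/cvgrPdist_lt : hi; apply.
Unshelve. all: by end_near.
Qed.

Lemma cvg_matrix (u : nat -> Mx) (l : Mx) :
  (forall i j, (fun k => u k i j) @ \oo --> l i j) -> u @ \oo --> l.
Proof.
move=> h A [P hP sPA]; suff : \forall k \near \oo, forall i j, P i j (u k i j).
  by apply: filterS => k hk; exact: sPA.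
apply: filter_forall => i; apply: filter_forall => j; exact: h _ _ _ (hP i j).
Qed.

Lemma lim_matrix (u : nat -> Mx) (l : Mx) :
  (forall i j, (fun k => u k i j) @ \oo --> l i j) -> limn u = l.
Proof.
move=> /cvg_matrix h; apply: cvg_lim h; exact: (@norm_hausdorff R[i] Mx).
Qed.

Let are (X : Mx) i j k := reC ((X ^+ k) i j).
Let aim (X : Mx) i j k := imC ((X ^+ k) i j).

(** A [limn] carries information only for a convergent sequence. The geometric bound [norm1X] makes
    the real series of each entry converge, and the matrix limit is then identified entrywise. *)
Lemma expm_entry (X : Mx) i j :
  reC (expm X i j) = limn (series (fun k => k`!%:R^-1 * reC ((X ^+ k) i j))) /\
  imC (expm X i j) = limn (series (fun k => k`!%:R^-1 * imC ((X ^+ k) i j))).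
Proof.
have hX k i' j' : norm1c ((X ^+ k) i' j') <= norm1 (1%:M : Mx) * norm1 X ^+ k.
  by rewrite (le_trans _ (norm1X X k)) // norm1c_le_norm1.
pose L : Mx := \matrix_(i, j)
  ((limn (series (fun k => k`!%:R^-1 * are X i j k))) +i*
   (limn (series (fun k => k`!%:R^-1 * aim X i j k))))%C.
suff -> : expm X = L by rewrite !mxE.
apply: lim_matrix => {}i {}j; rewrite mxE; apply: cvg_complex.
  rewrite [X in X @ _ --> _](_ : _ = series (fun k => k`!%:R^-1 * are X i j k)).
    apply: is_cvg_exp_series => [|k]; first exact: norm1_ge0 X.
    exact: le_trans (norm1c_re _) (hX _ _ _).
  apply/funext => m; rewrite /= /series /= summxE re_sum.
  by apply: eq_bigr => k _; rewrite mxE reC_invnat.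
rewrite [X in X @ _ --> _](_ : _ = series (fun k => k`!%:R^-1 * aim X i j k)).
  apply: is_cvg_exp_series => [|k]; first exact: norm1_ge0 X.
  exact: le_trans (norm1c_im _) (hX _ _ _).
apply/funext => m; rewrite /= /series /= summxE im_sum.
by apply: eq_bigr => k _; rewrite mxE imC_invnat.
Qed.

Lemma expm_tail : exists2 C : R, 0 <= C &
  forall X : Mx, norm1 (expm X - (1%:M + X)) <= C * (norm1 X ^+ 2 * expR (norm1 X)).
Proof.
have c0 : 0 <= norm1 (1%:M : Mx) by exact: norm1_ge0.
(* The two factors n+1 count the entries, 2 counts real and imaginary part, and [norm1 1%:M] is the
   constant of [norm1X]. *)
exists (n.+1%:R * n.+1%:R * (2 * norm1 (1%:M : Mx))) => [|X].
  by rewrite !mulr_ge0.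
rewrite -mulrA; apply: norm1_le => i j.
have hX k : norm1c ((X ^+ k) i j) <= norm1 (1%:M : Mx) * norm1 X ^+ k.
  by rewrite (le_trans _ (norm1X X k)) // norm1c_le_norm1.
have [er ei] := expm_entry X i j.
rewrite !mxE /norm1c !reD !imD reN imN reD imD er ei.
have := @exp_series_tail _ (are X i j) _ _ (norm1_ge0 X)
  (fun k => le_trans (norm1c_re _) (hX k)).
have := @exp_series_tail _ (aim X i j) _ _ (norm1_ge0 X)
  (fun k => le_trans (norm1c_im _) (hX k)).
rewrite /are /aim expr0 expr1 mxE -!mulrA => h1 h2.
by rewrite mulr_natl mulr2n; exact: lerD.
Qed.

Lemma diag_expr (X : Mx) k : (forall i j, i != j -> X i j = 0) ->
  forall i j, (X ^+ k) i j = if i == j then X i i ^+ k else 0.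
Proof.
move=> hX; elim: k => [|k ih] i j.
  by rewrite !expr0 mxE; case: (i == j).
rewrite exprSr mxE (bigD1 i) //= ih eqxx big1 ?addr0 => [|l li].
  by case: eqVneq => [<-|ij]; rewrite ?exprSr // (hX i j) ?mulr0.
by rewrite ih eq_sym (negPf li) mul0r.
Qed.

Lemma lim_series0 (u : nat -> R) : (forall k, u k = 0) -> limn (series u) = 0.
Proof.
move=> u0; rewrite (_ : series u = fun=> 0); first exact: lim_cst.
by apply/funext => m; rewrite /series /= big1.
Qed.

Lemma expm_diag (X : Mx) : G0minus X ->
  expm X = \matrix_(i, j) if i == j then (expR (reC (X i i)))%:C%C else 0.
Proof.
move=> [hX hr]; apply/matrixP => i j; rewrite mxE.
have [er ei] := expm_entry X i j.
have Xi k : X i i ^+ k = (reC (X i i) ^+ k)%:C%C.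
  by rewrite rmorphXn /=; congr (_ ^+ _); apply: complex_eqP => //=; exact: hr.
apply: complex_eqP; rewrite (er, ei).
  have [ij|ij] := eqVneq i j.
    rewrite /expR; congr (limn (series _)); apply/funext => k.
    by rewrite diag_expr // ij eqxx -ij Xi /= mulrC.
  rewrite lim_series0 // => k; first by rewrite diag_expr // (negPf ij) mulr0.
rewrite lim_series0 => [|k]; first by case: eqVneq.
by rewrite diag_expr //; case: eqVneq; rewrite ?Xi mulr0.
Qed.

End MatrixExp.

(** * Smooth functions are locally Lipschitz *)

Section RealDerivative.
Variable R : realType.
Implicit Types f g : R -> R.

Lemma is_derive_unique f (x d e : R) :
  is_derive x (1 : R) f d -> is_derive x (1 : R) f e -> d = e.
Proof. by move=> [_ <-] [_ <-]. Qed.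

Lemma is_derive_quadratic f (K r : R) : 0 < r ->
  (forall t, `|t| < r -> `|f t| <= K * t ^+ 2) -> is_derive (0 : R) (1 : R) f 0.
Proof.
move=> r0 hf.
have f0 : f 0 = 0.
  by apply/eqP; rewrite -normr_le0 (le_trans (hf 0 _)) ?normr0 // expr0n mulr0.
(* Testing the bound at the nonzero point r/2 forces K to be nonnegative. *)
have K0 : 0 <= K.
  have := hf (r / 2); rewrite ger0_norm; last by rewrite divr_ge0 // ltW.
  have -> : r / 2 < r by rewrite ltr_pdivrMr // ltr_pMr // ltr1n.
  move=> /(_ isT) /(le_trans (normr_ge0 _)); rewrite pmulr_lge0 //.
  by rewrite exprn_gt0 // divr_gt0.
have hc : (fun h : R => h^-1 *: (f (h *: 1 + 0) - f 0)) @ 0^' --> (0 : R).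
  apply/cvgrPdist_le => /= e e0; near=> h.
  have hn0 : h != 0 by near: h; exact: nbhs_dnbhs_neq.
  rewrite f0 subr0 sub0r normrN addr0 normrZ normfV -[h *: 1]/(h * 1) mulr1.
  rewrite ler_pdivrMl ?normr_gt0 //.
  apply: le_trans (hf h _) _.
    by near: h; apply: dnbhs0_lt.
  rewrite -(real_normK (num_real h)) expr2 mulrA mulrC ler_wpM2l //.
  (* The radius e / (K + 1) also makes sense when K = 0. *)
  apply: (@le_trans _ _ (K * (e / (K + 1)))).
    by rewrite ler_wpM2l //; near: h; apply: dnbhs0_le; rewrite divr_gt0 // ltr_wpDl.
  rewrite mulrCA ler_piMr ?(ltW e0) // ler_pdivrMr ?ltr_wpDl //; lra.
by split; [apply/cvg_ex; exists 0|exact: cvg_lim hc].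
Unshelve. all: by end_near.
Qed.

Lemma is_derive_close f g (d K r : R) : 0 < r ->
  (forall t, `|t| < r -> `|g t - f t| <= K * t ^+ 2) ->
  is_derive (0 : R) (1 : R) f d -> is_derive (0 : R) (1 : R) g d.
Proof.
move=> r0 h hf; have hg := is_derive_quadratic r0 h.
have := is_deriveD hf hg; rewrite addr0 (_ : f + _ = g) //.
by apply/funext => t /=; rewrite addrC subrK.
Qed.

(** [dirders] differentiates at parameter 0 only; shifting the parameter reaches the other points of
    a line. *)
Lemma derivable_translate f (s : R) :
  derivable f s (1 : R) = derivable (fun t => f (t + s)) 0 (1 : R).
Proof.
rewrite /derivable.
have -> : (fun h : R => h^-1 *: ((f \o shift s) (h *: 1) - f s)) =
    (fun h => h^-1 *: (((fun t => f (t + s)) \o shift 0) (h *: 1) - f (0 + s))).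
  by apply/funext => h; rewrite /= addr0 add0r.
by [].
Qed.

Lemma derive1_translate f (s : R) : derive1 f s = derive1 (fun t => f (t + s)) 0.
Proof.
rewrite /derive1.
have -> : (fun h : R => h^-1 *: (f (h + s) - f s)) =
    (fun h => h^-1 *: (f (h + 0 + s) - f (0 + s))).
  by apply/funext => h; rewrite addr0 add0r.
by [].
Qed.

Lemma mvt_bound f (c C : R) :
  (forall s, `|s| <= `|c| -> derivable f s (1 : R) /\ `|derive1 f s| <= C) ->
  `|f c - f 0| <= C * `|c|.
Proof.
move=> h.
(* The mean value theorem wants ordered endpoints; [key] is applied to [0, c] or [c, 0] according to
   the sign of c. *)
have key (a b : R) : a <= b -> `|a| <= `|c| -> `|b| <= `|c| ->
    `|f b - f a| <= C * (b - a).
  move=> ab ac bc.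
  have hs x : x \in `[a, b] -> `|x| <= `|c|.
    rewrite in_itv /= => /andP[ax xb]; move: ac bc; rewrite !ler_norml.
    by move=> /andP[? ?] /andP[? ?]; apply/andP; split; lra.
  have [x xab ->] : exists2 x, x \in `[a, b] & f b - f a = derive1 f x * (b - a).
    apply: MVT_segment => // [x xab|].
      have xab' : x \in `[a, b] by move: xab; rewrite !in_itv /= => /andP[? ?]; rewrite !ltW.
      by have [dx _] := h x (hs x xab'); split=> //; rewrite derive1E.
    apply: derivable_within_continuous => x xab.
    by have [] := h x (hs x xab).
  rewrite normrM (ger0_norm (_ : 0 <= b - a)) ?subr_ge0 // ler_wpM2r ?subr_ge0 //.
  by have [] := h x (hs x xab).
have [c0|c0] := leP 0 c.
  by rewrite [in leRHS](ger0_norm c0) -[X in _ * X]subr0; apply: key; rewrite ?normr0.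
rewrite distrC (ltr0_norm c0) -[- c]add0r; apply: key => //; rewrite ?normr0 //; exact: ltW.
Qed.

End RealDerivative.

Section LocallyLipschitz.
Variables (R : realType) (n : nat).
Local Notation Mx := 'M[R[i]]_n.+1.

Lemma nbhs_norm1 (g J : Mx) (A : set (Mx * Mx)) : nbhs (g, J) A ->
  exists2 d : R, 0 < d &
    forall g' J', norm1 (g' - g) + norm1 (J' - J) < d -> A (g', J').
Proof.
move/nbhs_ballP => [e /= e0 eA].
have ee : e = (reC e)%:C%C.
  by case: e e0 {eA} => x y; rewrite ltcE /= => /andP[/eqP -> _].
have re0 : 0 < reC e by move: e0; rewrite ee ltcR.
have close (X Y : Mx) : norm1 (Y - X) < reC e -> ball X e Y.
  move=> h; split=> // i j; rewrite /ball /= distrC ee.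
  apply: le_lt_trans (normc_le_norm1c _) _.
  rewrite ltcR (le_lt_trans _ h) //.
  by have := norm1c_le_norm1 (Y - X) i j; rewrite !mxE.
exists (reC e) => // g' J' h; apply: eA; split; apply: close => /=.
  by rewrite (le_lt_trans _ h) // lerDl norm1_ge0.
by rewrite (le_lt_trans _ h) // lerDr norm1_ge0.
Qed.

Lemma norm1_delta (z : R[i]) (i0 j0 : 'I_n.+1) :
  norm1 (z *: delta_mx i0 j0 : Mx) = norm1c z.
Proof.
rewrite /norm1 (bigD1 i0) //= (bigD1 j0) //= !mxE !eqxx mulr1.
rewrite big1 => [|j /negPf ij]; last by rewrite !mxE ij andbF mulr0 norm1c0.
rewrite addr0 big1 ?addr0 // => i /negPf ii.
by rewrite big1 // => j _; rewrite !mxE ii mulr0 norm1c0.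
Qed.

(** Index set of a real basis of gl(n,C) x gl(n,C): a matrix position, a flag for the factor ([true]
    for the first), and a flag for the unit ([true] for 1, [false] for i). *)
Let I := (('I_n.+1 * 'I_n.+1) * (bool * bool))%type.

Let unit_of (b : bool) : R[i] := if b then 1 else 'i%C.
Let dirmx (k : I) : Mx := unit_of k.2.2 *: delta_mx k.1.1 k.1.2.
Let dir (k : I) : Mx * Mx := if k.2.1 then (dirmx k, 0) else (0, dirmx k).
Let coef (X Y : Mx) (k : I) : R :=
  let Z := if k.2.1 then X else Y in
  if k.2.2 then reC (Z k.1.1 k.1.2) else imC (Z k.1.1 k.1.2).

Let norm1_dirmx k : norm1 (dirmx k) = 1.
Proof.
rewrite norm1_delta /norm1c /unit_of.
by case: k.2.2; rewrite /reC /imC /= normr0 normr1 ?addr0 ?add0r.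
Qed.

Let norm1_dir k : norm1 (dir k).1 + norm1 (dir k).2 = 1.
Proof. by rewrite /dir; case: k.2.1; rewrite /= norm10 norm1_dirmx ?addr0 ?add0r. Qed.

Let sum_dirmx (X : Mx) :
  X = \sum_p (rscal (reC (X p.1 p.2)) (dirmx (p, (true, true))) +
              rscal (imC (X p.1 p.2)) (dirmx (p, (true, false)))).
Proof.
rewrite [LHS]matrix_sum_delta (pair_bigA _ (fun i j => X i j *: delta_mx i j)) /=.
apply: eq_bigr => p _; rewrite /rscal /dirmx /= !scalerA -scalerDl.
congr (_ *: _); apply: complex_eqP; rewrite !(reD, imD, reM, imM) /reC /imC /=; ring.
Qed.

Let rscal0 (c : R) : rscal c (0 : Mx) = 0.
Proof. exact: scaler0. Qed.

Let sum_dir (X Y : Mx) :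
  \sum_k rscal (coef X Y k) (dir k).1 = X /\ \sum_k rscal (coef X Y k) (dir k).2 = Y.
Proof.
split.
  rewrite -(pair_bigA _ (fun p b => rscal (coef X Y (p, b)) (dir (p, b)).1)) /=.
  rewrite [RHS]sum_dirmx; apply: eq_bigr => p _.
  rewrite -(pair_bigA _ (fun a b => rscal (coef X Y (p, (a, b))) (dir (p, (a, b))).1)) /=.
  by rewrite !big_bool /dir /coef /= !rscal0 !addr0.
rewrite -(pair_bigA _ (fun p b => rscal (coef X Y (p, b)) (dir (p, b)).2)) /=.
rewrite [RHS]sum_dirmx; apply: eq_bigr => p _.
rewrite -(pair_bigA _ (fun a b => rscal (coef X Y (p, (a, b))) (dir (p, (a, b))).2)) /=.
by rewrite !big_bool /dir /coef /= !rscal0 !add0r.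
Qed.

(** A path along the coordinate axes thus has exactly the length of its total displacement, so no
    constant is lost below. *)
Let sum_coef (X Y : Mx) : \sum_k `|coef X Y k| = norm1 X + norm1 Y.
Proof.
rewrite -(pair_bigA _ (fun p b => `|coef X Y (p, b)|)) /=.
rewrite /norm1 -big_split /= -[RHS](eq_bigr _ (fun _ _ => big_split _ _ _ _ _)).
rewrite (pair_bigA _ (fun i j => norm1c (X i j) + norm1c (Y i j))) /=.
apply: eq_bigr => p _.
rewrite -(pair_bigA _ (fun a b => `|coef X Y (p, (a, b))|)) /=.
by rewrite !big_bool.
Qed.

Variable F : Mx -> Mx -> R.
Hypothesis sF : smooth_on_M F.

Section Ball.
Variables (g J : Mx) (C d : R).
Hypothesis hball : forall g' J', norm1 (g' - g) + norm1 (J' - J) < d ->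
  g' \in unitmx /\ forall k : I, `|dirders F [:: dir k] g' J'| <= C.

(** Adding [|c|] to the distance keeps the whole segment in the ball, where the mean value bound
    applies. *)
Let lipschitz_step (g' J' : Mx) (c : R) (k : I) :
  norm1 (g' - g) + norm1 (J' - J) + `|c| < d ->
  `|F (g' + rscal c (dir k).1) (J' + rscal c (dir k).2) - F g' J'| <= C * `|c|.
Proof.
move=> hd; pose f t := F (g' + rscal t (dir k).1) (J' + rscal t (dir k).2).
have rs0 (X : Mx) : rscal 0 X = 0 by rewrite /rscal scale0r.
have f0 : F g' J' = f 0 by rewrite /f !rs0 !addr0.
have ft t s : f (t + s) = F (g' + rscal s (dir k).1 + rscal t (dir k).1)
                            (J' + rscal s (dir k).2 + rscal t (dir k).2).
  by rewrite /f !rscalD !(addrC (rscal t _)) !addrA.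
rewrite f0; apply: mvt_bound => s sc.
have [] := hball (g' := g' + rscal s (dir k).1) (J' := J' + rscal s (dir k).2).
  rewrite ![_ + rscal s _]addrC -!addrA.
  apply: le_lt_trans (lerD (norm1D _ _) (norm1D _ _)) _.
  rewrite !norm1_rscal addrACA -mulrDr norm1_dir mulr1 addrC.
  by apply: le_lt_trans hd; rewrite lerD2l.
move=> gu hC; rewrite derivable_translate derive1_translate.
rewrite (_ : (fun t => f (t + s)) = fun t => F (g' + rscal s (dir k).1 + rscal t (dir k).1)
                            (J' + rscal s (dir k).2 + rscal t (dir k).2)).
  by split; [exact: (sF [::]).1 | exact: hC].
by apply/funext => t; exact: ft.
Qed.

(** Induction along the axes; the hypothesis carries the length still to be travelled, so every
    corner of the path stays in the ball. *)
Let lipschitz_list (s : seq I) (c : I -> R) (g' J' : Mx) :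
  norm1 (g' - g) + norm1 (J' - J) + \sum_(k <- s) `|c k| < d ->
  `|F (g' + \sum_(k <- s) rscal (c k) (dir k).1) (J' + \sum_(k <- s) rscal (c k) (dir k).2)
    - F g' J'| <= C * \sum_(k <- s) `|c k|.
Proof.
elim: s g' J' => [|k s ih] g' J'; first by rewrite !big_nil !addr0 subrr normr0 mulr0.
rewrite !big_cons => hd; rewrite !addrA.
set g1 := g' + rscal _ _; set J1 := J' + rscal _ _.
rewrite -(subrKA (F g1 J1)) mulrDr [leRHS]addrC.
apply: le_trans (ler_normD _ _) _.
have s0 : 0 <= \sum_(k <- s) `|c k| by exact: sumr_ge0.
rewrite lerD //; last first.
  by apply: lipschitz_step; apply: le_lt_trans hd; rewrite lerD2l lerDl.
apply: ih; apply: le_lt_trans hd; rewrite addrA lerD2r.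
rewrite /g1 /J1 ![_ + rscal _ _]addrC -!addrA.
apply: le_trans (lerD (norm1D _ _) (norm1D _ _)) _.
by rewrite !norm1_rscal addrACA -mulrDr norm1_dir mulr1 addrC addrA.
Qed.

Lemma lipschitz_ball (g1 J1 g2 J2 : Mx) :
  norm1 (g1 - g) + norm1 (J1 - J) + (norm1 (g2 - g1) + norm1 (J2 - J1)) < d ->
  `|F g2 J2 - F g1 J1| <= C * (norm1 (g2 - g1) + norm1 (J2 - J1)).
Proof.
rewrite -(sum_coef (g2 - g1)) => hd.
have := lipschitz_list hd; have [-> ->] := sum_dir (g2 - g1) (J2 - J1).
by rewrite (addrC g1) (addrC J1) !subrK.
Qed.

End Ball.

Lemma smooth_lipschitz (g J : Mx) : g \in unitmx ->
  exists C d : R, 0 < d /\ forall g1 J1 g2 J2,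
    norm1 (g1 - g) + norm1 (J1 - J) < d -> norm1 (g2 - g) + norm1 (J2 - J) < d ->
    `|F g2 J2 - F g1 J1| <= C * (norm1 (g2 - g1) + norm1 (J2 - J1)).
Proof.
move=> gu; pose D k (p : Mx * Mx) := dirders F [:: dir k] p.1 p.2.
(* The summands are positive, so C exceeds each derivative at (g, J) by at least 1 and, by
   continuity, bounds all of them nearby. *)
pose C := \sum_k (`|D k (g, J)| + 1).
have nearD : \forall p \near (g, J), forall k, `|D k p| <= C.
  apply: (@filter_forall _ I (fun k p => is_true (`|D k p| <= C)) (nbhs (g, J)) _) => k.
  have /cvgrPdist_lt/(_ 1 ltr01) := (sF [:: dir k]).2 g J gu.
  apply: filterS => p hp; rewrite /C (bigD1 k) //= ler_wpDr //.
    by apply: sumr_ge0 => l _; rewrite addr_ge0.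
  rewrite -[D k p](subrK (D k (g, J))) addrC; apply: le_trans (ler_normD _ _) _.
  by rewrite lerD2l distrC ltW.
have [d0 d00 hd0] := nbhs_norm1 nearD.
(* Within d1 of g every matrix is invertible by [unitmx_near]. *)
pose d1 := (norm1 (invmx g) + 1)^-1.
have n1 : 0 < norm1 (invmx g) + 1 by rewrite ltr_wpDl // norm1_ge0.
pose d := Num.min d0 d1.
have d_gt0 : 0 < d by rewrite /d lt_min d00 invr_gt0.
(* [lipschitz_ball] needs |p1 - p| + |p2 - p1| < d, and the left side is at most 2 |p1 - p| + |p2 -
   p|. *)
exists C, (d / 3); split=> [|g1 J1 g2 J2 h1 h2]; first by rewrite divr_gt0.
apply: (@lipschitz_ball g J C d).
  move=> g' J'; rewrite lt_min => /andP[ha hb]; split; last exact: hd0.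
  apply: (unitmx_near gu); have hg : norm1 (g' - g) < d1.
    by apply: le_lt_trans hb; rewrite lerDl norm1_ge0.
  apply: le_lt_trans (_ : (norm1 (invmx g) + 1) * norm1 (g' - g) < 1).
    by rewrite mulrDl lerDl mul1r norm1_ge0.
  by rewrite -ltr_pdivlMl // mulr1.
have tri (X Y Z : Mx) : norm1 (X - Y) <= norm1 (X - Z) + norm1 (Y - Z).
  by rewrite (_ : X - Y = (X - Z) - (Y - Z)) ?norm1B // opprB addrA subrK.
have := tri g2 g1 g; have := tri J2 J1 J; move: h1 h2; lra.
Qed.

Lemma is_derive_curve (g J : Mx) (g1 J1 g2 J2 : R -> Mx) (K r l : R) :
  g \in unitmx -> 0 < r ->
  (forall t, `|t| < r ->
    norm1 (g1 t - g) + norm1 (J1 t - J) <= K * `|t| /\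
    norm1 (g2 t - g1 t) + norm1 (J2 t - J1 t) <= K * t ^+ 2) ->
  is_derive (0 : R) (1 : R) (fun t => F (g1 t) (J1 t)) l ->
  is_derive (0 : R) (1 : R) (fun t => F (g2 t) (J2 t)) l.
Proof.
move=> gu r0 h; have [C [d [d0 hC]]] := smooth_lipschitz J gu.
have K0 : 0 <= K.
  have := (h (r / 2) _).2; rewrite ger0_norm; last by rewrite divr_ge0 // ltW.
  have -> : r / 2 < r by rewrite ltr_pdivrMr // ltr_pMr // ltr1n.
  move=> /(_ isT) /(le_trans (addr_ge0 (norm1_ge0 _) (norm1_ge0 _))).
  by rewrite pmulr_lge0 // exprn_gt0 // divr_gt0.
(* For |t| < 1 both curves lie within K |t| + K t^2 <= 2 K |t| of (g, J), which this radius makes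
   smaller than d; the added 1 covers K = 0. *)
pose r' := Num.min (Num.min r 1) (d / (2 * K + 1)).
have K1 : 0 < 2 * K + 1 by lra.
have r'0 : 0 < r' by rewrite /r' !lt_min r0 ltr01 divr_gt0.
apply: (is_derive_close (K := `|C| * K) r'0) => t.
rewrite !lt_min ltr_pdivlMr // => /andP[/andP[tr t1] td].
have [ha hb] := h t tr.
have t2 : t ^+ 2 <= `|t|.
  by rewrite -(real_normK (num_real t)) expr2 ler_piMl // ltW.
have Kt2 : K * t ^+ 2 <= K * `|t| by rewrite ler_wpM2l.
have tri (X Y Z : Mx) : norm1 (X - Z) <= norm1 (X - Y) + norm1 (Y - Z).
  by rewrite -(subrKA Y) norm1D.
apply: le_trans (hC (g1 t) (J1 t) (g2 t) (J2 t) _ _) _.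
- by apply: le_lt_trans ha _; have := normr_ge0 t; nra.
- have := tri (g2 t) (g1 t) g; have := tri (J2 t) (J1 t) J.
  have := normr_ge0 t; nra.
apply: (@le_trans _ _ (`|C| * (norm1 (g2 t - g1 t) + norm1 (J2 t - J1 t)))).
  by rewrite ler_wpM2r ?ler_norm // addr_ge0 // norm1_ge0.
by rewrite -mulrA ler_wpM2l.
Qed.

End LocallyLipschitz.

(** * Hermitian and anti-Hermitian matrices *)

Section RealInnerProduct.
Variables (R : realType) (n : nat).
Local Notation Mx := 'M[R[i]]_n.+1.
Implicit Types X Y Z : Mx.

Lemma adjmE X i j : adjm X i j = (X j i)^*%C.
Proof. by rewrite !mxE. Qed.

Lemma adjmD X Y : adjm (X + Y) = adjm X + adjm Y.
Proof. by rewrite /adjm map_mxD linearD. Qed.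

Lemma adjmN X : adjm (- X) = - adjm X.
Proof. by rewrite /adjm map_mxN linearN. Qed.

Lemma adjm1 : adjm (1%:M : Mx) = 1%:M.
Proof. by rewrite /adjm map_mx1 trmx1. Qed.

Lemma adjmM X Y : adjm (X *m Y) = adjm Y *m adjm X.
Proof. by rewrite /adjm map_mxM trmx_mul. Qed.

Lemma adjmK X : adjm (adjm X) = X.
Proof. by apply/matrixP => i j; rewrite !adjmE conjcK. Qed.

Lemma adjm_rscal (t : R) X : adjm (rscal t X) = rscal t (adjm X).
Proof. by apply/matrixP => i j; rewrite !mxE rmorphM /= oppr0. Qed.

Let halfD : (2^-1 + 2^-1 : R) = 1.
Proof. lra. Qed.

Lemma half_rscal X : (2%:R : R[i])^-1 *: X = rscal 2^-1 X.
Proof. by rewrite /rscal fmorphV /= rmorph_nat. Qed.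

Lemma rscalmxl (t : R) X Y : rscal t X *m Y = rscal t (X *m Y).
Proof. by rewrite /rscal scalemxAl. Qed.

Lemma rscalmxr (t : R) X Y : X *m rscal t Y = rscal t (X *m Y).
Proof. by rewrite /rscal scalemxAr. Qed.

Lemma norm1_adjm X : norm1 (adjm X) = norm1 X.
Proof.
rewrite /norm1 exchange_big /=; apply: eq_bigr => i _; apply: eq_bigr => j _.
by rewrite adjmE; case: (X i j) => a b; rewrite /norm1c /reC /imC /= normrN.
Qed.

Lemma pplus_pminus X : X = pplus X + pminus X.
Proof.
rewrite /pplus /pminus !half_rscal -rscalDr addrACA addNr addr0.
by rewrite rscalDr -rscalD halfD rscal1.
Qed.

Lemma adjm_pplus X : adjm (pplus X) = - pplus X.
Proof.
by rewrite /pplus half_rscal adjm_rscal adjmD adjmN adjmK -opprB /rscal scalerN.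
Qed.

Lemma adjm_pminus X : adjm (pminus X) = pminus X.
Proof. by rewrite /pminus half_rscal adjm_rscal adjmD adjmK addrC. Qed.

Lemma ipC X Y : ip X Y = ip Y X.
Proof. by rewrite /ip mxtrace_mulC. Qed.

Lemma ipDl X Y Z : ip (X + Y) Z = ip X Z + ip Y Z.
Proof. by rewrite /ip mulmxDl raddfD reD. Qed.

Lemma ipDr X Y Z : ip X (Y + Z) = ip X Y + ip X Z.
Proof. by rewrite ipC ipDl !(ipC X). Qed.

Lemma ipNl X Y : ip (- X) Y = - ip X Y.
Proof. by rewrite /ip mulNmx raddfN reN. Qed.

Lemma ipNr X Y : ip X (- Y) = - ip X Y.
Proof. by rewrite ipC ipNl ipC. Qed.

Lemma ipBl X Y Z : ip (X - Y) Z = ip X Z - ip Y Z.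
Proof. by rewrite ipDl ipNl. Qed.

Lemma ipBr X Y Z : ip X (Y - Z) = ip X Y - ip X Z.
Proof. by rewrite ipDr ipNr. Qed.

Lemma ip0l X : ip 0 X = 0.
Proof. by rewrite /ip mul0mx raddf0. Qed.

Lemma ip_mulmx X Y Z : ip (X *m Y) Z = ip X (Y *m Z).
Proof. by rewrite /ip mulmxA. Qed.

Lemma ip_lie X Y Z : ip (lie X Y) Z = ip X (lie Y Z).
Proof.
rewrite /lie ipBl ipBr !ip_mulmx; congr (_ - _).
by rewrite ipC ip_mulmx.
Qed.

Lemma lieC X Y : lie X Y = - lie Y X.
Proof. by rewrite /lie opprB. Qed.

Lemma lieDl X Y Z : lie (X + Y) Z = lie X Z + lie Y Z.
Proof. by rewrite /lie mulmxDl mulmxDr opprD addrACA. Qed.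

Lemma lieDr X Y Z : lie Z (X + Y) = lie Z X + lie Z Y.
Proof. by rewrite lieC lieDl opprD -!(lieC Z). Qed.

Lemma lieNl X Y : lie (- X) Y = - lie X Y.
Proof. by rewrite /lie mulNmx mulmxN opprB opprK addrC. Qed.

Lemma adjm_lie X Y : adjm (lie X Y) = lie (adjm Y) (adjm X).
Proof. by rewrite /lie adjmD adjmN !adjmM. Qed.

Lemma ip_adjm X Y : ip (adjm X) (adjm Y) = ip X Y.
Proof.
rewrite /ip -adjmM mxtrace_mulC /mxtrace !re_sum; apply: eq_bigr => i _.
by rewrite adjmE; case: (_ i i).
Qed.

(** The adjoint preserves [ip] but changes the sign of exactly one argument. *)
Lemma ip_herm_antiherm X Y : adjm X = X -> adjm Y = - Y -> ip X Y = 0.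
Proof.
by move=> hX hY; have := ip_adjm X Y; rewrite hX hY ipNr => h; lra.
Qed.

Lemma ip_pplus X Y : adjm Y = - Y -> ip (pplus X) Y = ip X Y.
Proof.
move=> hY; rewrite [in RHS](pplus_pminus X) ipDl.
by rewrite (ip_herm_antiherm (adjm_pminus X) hY) addr0.
Qed.

Lemma ip_pminus X Y : adjm Y = Y -> ip (pminus X) Y = ip X Y.
Proof.
move=> hY; rewrite [in RHS](pplus_pminus X) ipDl ipC (ipC (pplus X)).
by rewrite (ip_herm_antiherm hY (adjm_pplus X)) add0r.
Qed.

Lemma mulmx_adjm_diag X i :
  reC ((X *m adjm X) i i) = \sum_j (reC (X i j) ^+ 2 + imC (X i j) ^+ 2).
Proof.
rewrite mxE re_sum; apply: eq_bigr => j _; rewrite adjmE.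
by case: (X i j) => a b; rewrite /reC /imC /= mulrN opprK !expr2.
Qed.

Lemma mulmx_adjm_entry X i j :
  reC (X i j) ^+ 2 + imC (X i j) ^+ 2 <= reC ((X *m adjm X) i i).
Proof.
rewrite mulmx_adjm_diag (bigD1 j) //= lerDl sumr_ge0 // => k _.
by rewrite addr_ge0 // sqr_ge0.
Qed.

Lemma entry_eq0 (z : R[i]) : reC z ^+ 2 + imC z ^+ 2 <= 0 -> z = 0.
Proof.
move=> h; apply: complex_eqP; apply/eqP; rewrite -sqrf_eq0 eq_le sqr_ge0 andbT.
  by apply: le_trans h; rewrite lerDl sqr_ge0.
by apply: le_trans h; rewrite lerDr sqr_ge0.
Qed.

Lemma mulmx_adjm_eq0 X : X *m adjm X = 0 -> X = 0.
Proof.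
move=> h; apply/matrixP => i j; rewrite [RHS]mxE; apply: entry_eq0.
by have := mulmx_adjm_entry X i j; rewrite h mxE.
Qed.

(** [ip X (adjm X)] is the squared Frobenius norm. This positive form yields nondegeneracy of the
    indefinite [ip]. *)
Lemma ip_adjm_eq0 X : ip X (adjm X) = 0 -> X = 0.
Proof.
rewrite /ip /mxtrace re_sum => h; apply/matrixP => i j; rewrite [RHS]mxE.
have pos k : 0 <= reC ((X *m adjm X) k k).
  by rewrite mulmx_adjm_diag sumr_ge0 // => l _; rewrite addr_ge0 // sqr_ge0.
apply: entry_eq0; apply: le_trans (mulmx_adjm_entry X i j) _.
by rewrite -h [leRHS](bigD1 i) //= lerDl sumr_ge0.
Qed.

Lemma ip_nondegenerate X Y : (forall Z, ip X Z = ip Y Z) -> X = Y.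
Proof.
move=> h; apply/eqP; rewrite -subr_eq0; apply/eqP; apply: ip_adjm_eq0.
by rewrite ipBl h subrr.
Qed.

(** The choice A = [pplus X] gives minus the squared Frobenius norm of [pplus X]. *)
Lemma pplus_eq0 X : (forall A, adjm A = - A -> ip X A = 0) -> pplus X = 0.
Proof.
move=> h; apply: ip_adjm_eq0.
by rewrite adjm_pplus ipNr ip_pplus ?h ?oppr0 // adjm_pplus.
Qed.

(* The Cayley transform of B: a unitary curve t |-> cayley (t A / 2) with velocity
   A at t = 0 replaces t |-> exp (t A), so unitarity of exponentials is not needed. *)
Definition cayley (B : Mx) : Mx := invmx (1%:M - B) *m (1%:M + B).

(** If K = K B, then K K^* = K (K B)^* = - K B K^* = - K K^*, so K = 0. *)
Lemma unitmx_1B (B : Mx) : adjm B = - B -> 1%:M - B \in unitmx.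
Proof.
move=> hB; rewrite -row_free_unit -kermx_eq0; apply/eqP.
have : kermx (1%:M - B) *m (1%:M - B) = 0 by apply/sub_kermxP.
move: (kermx _) => K; rewrite mulmxBr mulmx1 => /eqP; rewrite subr_eq0 => /eqP hK.
apply: mulmx_adjm_eq0; have h : K *m adjm K = - (K *m adjm K).
  rewrite [LHS](_ : _ = K *m adjm (K *m B)); last by rewrite -hK.
  by rewrite adjmM hB mulNmx mulmxN mulmxA -hK.
have : rscal 2 (K *m adjm K) = 0 by rewrite rscalD rscal1 {1}h addNr.
by move/(congr1 (rscal 2^-1)); rewrite -rscalM mulVf ?pnatr_eq0 // rscal1 /rscal scaler0.
Qed.

(** The adjoint exchanges 1 - B and 1 + B, and these two matrices commute. *)
Lemma cayley_unitary (B : Mx) : adjm B = - B -> unitary (cayley B).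
Proof.
move=> hB; have hu := unitmx_1B hB; rewrite /unitary /cayley adjmM adjmD adjm1 hB.
set V := invmx _.
have hV : adjm V *m (1%:M + B) = 1%:M.
  have -> : 1%:M + B = adjm (1%:M - B) by rewrite adjmD adjmN adjm1 hB opprK.
  by rewrite -adjmM mulmxV // adjm1.
have comm : (1%:M + B) *m (1%:M - B) = (1%:M - B) *m (1%:M + B).
  rewrite [LHS]mulmxBr mulmx1 [in LHS]mulmxDl mul1mx opprD addrA addrK.
  by rewrite mulmxDr mulmx1 mulmxBl mul1mx addrA subrK.
rewrite mulmxA -(mulmxA V) comm (mulmxA V) mulVmx // mul1mx.
exact: mulmx1C.
Qed.

(** An exact second-order remainder: (1 - B) (u + 1) = 2 gives B (u + 1) = u - 1, which is used
    twice. Since unitary matrices are bounded, the remainder is O(|B|^2) uniformly in B. *)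
Lemma cayley_expand (B : Mx) : adjm B = - B ->
  cayley B - (1%:M + (B + B)) = B *m B *m (cayley B + 1%:M).
Proof.
move=> hB; have hu := unitmx_1B hB; set u := cayley B.
have h1 : (1%:M - B) *m (u + 1%:M) = 1%:M + 1%:M.
  by rewrite mulmxDr mulmx1 /u /cayley mulmxA mulmxV // mul1mx addrACA subrr addr0.
have h2 : B *m (u + 1%:M) = u - 1%:M.
  move: h1; rewrite mulmxBl mul1mx => /eqP; rewrite subr_eq => /eqP h.
  move: h; set Y := B *m _ => h; apply/eqP.
  by rewrite eq_sym subr_eq -(inj_eq (addIr 1%:M)) h [eqbLHS]addrC addrA.
rewrite -mulmxA h2 mulmxBr mulmx1 opprD addrA -h2 mulmxDr mulmx1.
by rewrite opprD addrA addrK.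
Qed.

Lemma norm1_unitary (u : Mx) : unitary u -> norm1 u <= n.+1%:R * n.+1%:R * 2.
Proof.
move=> hu; apply: norm1_le => i j.
have := mulmx_adjm_entry u i j; rewrite hu mxE eqxx => h; rewrite /norm1c.
have le1 (x : R) : x ^+ 2 <= 1 -> `|x| <= 1.
  by move=> hx; rewrite ler_norml; apply/andP; split; nra.
have h1 : reC (1%:R : R[i]) = 1 by [].
rewrite h1 in h; rewrite (_ : 2 = 1 + 1) // lerD // le1 // (le_trans _ h) //.
  by rewrite lerDl sqr_ge0.
by rewrite lerDr sqr_ge0.
Qed.

Lemma unitary_unitmx (u : Mx) : unitary u -> u \in unitmx /\ invmx u = adjm u.
Proof.
move=> h; have hu : u \in unitmx by have [] := mulmx1_unit h.
by split=> //; rewrite -[LHS]mulmx1 -h mulmxA mulVmx // mul1mx.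
Qed.

End RealInnerProduct.

(** * First-order jets of curves *)

Section Jets.
Variables (R : realType) (n : nat).
Local Notation Mx := 'M[R[i]]_n.+1.
Implicit Types (x y : R -> Mx) (a b c d : Mx).

(** Value a and velocity b at t = 0 with a uniform O(t^2) remainder. This form passes to products
    and adjoints and is what [is_derive_curve] consumes. *)
Definition jet1 x a b : Prop :=
  exists K : R, forall t : R, `|t| < 1 -> norm1 (x t - (a + rscal t b)) <= K * t ^+ 2.

Lemma jet1_eq x a b a' b' : jet1 x a b -> a = a' -> b = b' -> jet1 x a' b'.
Proof. by move=> h <- <-. Qed.

Lemma jet1_cst a : jet1 (fun=> a) a 0.
Proof.
by exists 0 => t _; rewrite /rscal scaler0 addr0 subrr norm10 mul0r.
Qed.

Lemma jet1_line a b : jet1 (fun t => a + rscal t b) a b.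
Proof. by exists 0 => t _; rewrite subrr norm10 mul0r. Qed.

Lemma jet1_adjm x a b : jet1 x a b -> jet1 (fun t => adjm (x t)) (adjm a) (adjm b).
Proof.
move=> [K h]; exists K => t t1.
by rewrite -adjm_rscal -adjmD -adjmN -adjmD norm1_adjm h.
Qed.

Lemma jet1_bound x a b : jet1 x a b ->
  exists K : R, forall t, `|t| < 1 -> norm1 (x t) <= K /\ norm1 (x t - a) <= K * `|t|.
Proof.
move=> [K h]; exists (norm1 a + (norm1 b + `|K|)) => t t1.
have b0 := norm1_ge0 b; have a0 := norm1_ge0 a; have K0 := normr_ge0 K.
have hxa : norm1 (x t - a) <= (norm1 b + `|K|) * `|t|.
  have -> : x t - a = rscal t b + (x t - (a + rscal t b)).
    by rewrite [RHS]addrC opprD addrA subrK.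
  apply: le_trans (norm1D _ _) _; rewrite norm1_rscal mulrC mulrDl lerD2l.
  apply: le_trans (h t t1) _; apply: le_trans (_ : `|K| * t ^+ 2 <= _).
    by rewrite ler_wpM2r ?sqr_ge0 // ler_norm.
  rewrite ler_wpM2l // -(real_normK (num_real t)) expr2 ler_piMl //; exact: ltW.
split; last by apply: le_trans hxa _; rewrite ler_wpM2r // lerDr.
rewrite -(subrK a (x t)); apply: le_trans (norm1D _ _) _.
rewrite addrC lerD2l; apply: le_trans hxa _.
by rewrite ler_piMr ?addr_ge0 // ltW.
Qed.

Lemma jet1M x y a b c d : jet1 x a b -> jet1 y c d ->
  jet1 (fun t => x t *m y t) (a *m c) (a *m d + b *m c).
Proof.
move=> [K hx] hy; have [L hL] := jet1_bound hy; case: hy => M hy.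
exists (`|K| * `|L| + ((norm1 a + norm1 b) * `|M| + norm1 b * norm1 d)) => t t1.
(* Leibniz: besides the two remainders, the product of the linear terms leaves t^2 b d. *)
have -> : x t *m y t - (a *m c + rscal t (a *m d + b *m c)) =
    (x t - (a + rscal t b)) *m y t +
    ((a + rscal t b) *m (y t - (c + rscal t d)) + rscal t (rscal t (b *m d))).
  rewrite mulmxBl mulmxBr addrA addrA subrK -addrA; congr (_ + _).
  rewrite mulmxDl !mulmxDr !rscalmxl !rscalmxr rscalDr.
  set p := a *m c; set q := rscal t (a *m d); set r := rscal t (b *m c).
  set s := rscal t (rscal t (b *m d)).
  by rewrite !opprD !addrA addrNK; congr (_ + _); rewrite -!addrA.
have t20 : 0 <= t ^+ 2 by exact: sqr_ge0.
have tt : t ^+ 2 = `|t| * `|t| by rewrite -normrM ger0_norm.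
apply: le_trans (norm1D _ _) _; rewrite mulrDl lerD //.
  apply: le_trans (norm1M _ _) _.
  have hl := le_trans (hL t t1).1 (ler_norm L).
  rewrite mulrAC ler_pM ?norm1_ge0 //; apply: le_trans (hx t t1) _.
  by rewrite ler_wpM2r // ler_norm.
apply: le_trans (norm1D _ _) _; rewrite mulrDl lerD //.
  apply: le_trans (norm1M _ _) _; rewrite -mulrA ler_pM ?norm1_ge0 //.
    apply: le_trans (norm1D _ _) _; rewrite lerD2l norm1_rscal.
    by rewrite ler_piMl ?norm1_ge0 // ltW.
  by apply: le_trans (hy t t1) _; rewrite ler_wpM2r // ler_norm.
rewrite !norm1_rscal mulrA -tt mulrC ler_wpM2r //; exact: norm1M.
Qed.

Lemma jet1_expm b : jet1 (fun t => expm (rscal t b)) 1%:M b.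
Proof.
have [C C0 h] := expm_tail R n.
exists (C * (norm1 b ^+ 2 * expR (norm1 b))) => t t1.
apply: le_trans (h (rscal t b)) _; rewrite norm1_rscal.
have tt : `|t| ^+ 2 = t ^+ 2 by rewrite real_normK // num_real.
rewrite exprMn tt.
rewrite [leRHS](_ : _ = C * (t ^+ 2 * norm1 b ^+ 2 * expR (norm1 b))); last by ring.
rewrite ler_wpM2l // ler_wpM2l //; first by rewrite mulr_ge0 // sqr_ge0.
by rewrite ler_expR ler_piMl ?norm1_ge0 // ltW.
Qed.

Lemma exists_unitary_curve b : adjm b = - b ->
  exists u : R -> Mx, (forall t, unitary (u t)) /\ jet1 u 1%:M b.
Proof.
move=> hb; pose B (t : R) := rscal (t * 2^-1) b.
have hB t : adjm (B t) = - B t by rewrite adjm_rscal hb /rscal scalerN.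
exists (fun t => cayley (B t)); split=> [t|]; first exact: cayley_unitary.
(* Bounds the remainder B B (u + 1) of [cayley_expand], with [norm1_unitary] for u. *)
pose L := norm1 b * norm1 b * (n.+1%:R * n.+1%:R * 2 + norm1 (1%:M : Mx)).
exists L => t t1.
have BB : B t + B t = rscal t b.
  by rewrite -rscalD -mulrDr (_ : 2^-1 + 2^-1 = 1 :> R) ?mulr1 //; lra.
rewrite -BB cayley_expand //.
have nB : norm1 (B t) <= `|t| * norm1 b.
  rewrite norm1_rscal normrM ler_wpM2r ?norm1_ge0 // ler_piMr //.
  by rewrite ger0_norm ?invr_ge0 // invf_le1 // ler1n.
have tt : t ^+ 2 = `|t| * `|t| by rewrite -normrM ger0_norm // sqr_ge0.
apply: le_trans (norm1M _ _) _.
rewrite /L [leRHS](_ : _ = t ^+ 2 * (norm1 b * norm1 b) *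
  (n.+1%:R * n.+1%:R * 2 + norm1 (1%:M : Mx))); last by ring.
apply: ler_pM; rewrite ?norm1_ge0 //.
  by apply: le_trans (norm1M _ _) _; rewrite tt mulrACA; apply: ler_pM; rewrite ?norm1_ge0.
by apply: le_trans (norm1D _ _) _; rewrite lerD2r norm1_unitary //; exact: cayley_unitary.
Qed.

End Jets.

(** * Gradients of invariant functions *)

Section Gradients.
Variables (R : realType) (n : nat).
Local Notation Mx := 'M[R[i]]_n.+1.
Variable F : Mx -> Mx -> R.

(** Plays the role of the chain rule: exponential, Cayley and straight curves with equal 1-jets can
    be exchanged. *)
Lemma is_derive_jet (g J X Y : Mx) (g1 J1 g2 J2 : R -> Mx) (l : R) :
  smooth_on_M F -> g \in unitmx ->
  jet1 g1 g X -> jet1 g2 g X -> jet1 J1 J Y -> jet1 J2 J Y ->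
  is_derive (0 : R) (1 : R) (fun t => F (g1 t) (J1 t)) l ->
  is_derive (0 : R) (1 : R) (fun t => F (g2 t) (J2 t)) l.
Proof.
move=> sF gu hg1 hg2 hJ1 hJ2.
have [K1 h1] := jet1_bound hg1; have [K2 h2] := jet1_bound hJ1.
move: hg1 hg2 hJ1 hJ2 => [L1 k1] [L2 k2] [L3 k3] [L4 k4].
apply: (@is_derive_curve _ _ F sF g J g1 J1 g2 J2
  (`|K1| + `|K2| + (`|L1| + `|L2|) + (`|L3| + `|L4|)) 1) => // t t1.
have tri (A B C : Mx) : norm1 (A - B) <= norm1 (B - C) + norm1 (A - C).
  by rewrite -(subrKA C) [leRHS]addrC -(norm1N (B - C)) opprB norm1D.
have abs (a c b : R) : 0 <= b -> a <= c * b -> a <= `|c| * b.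
  by move=> b0 /le_trans; apply; rewrite ler_wpM2r // ler_norm.
have t0 := normr_ge0 t; have t20 := sqr_ge0 t.
have a1 := abs _ _ _ t0 (h1 t t1).2; have a2 := abs _ _ _ t0 (h2 t t1).2.
have b1 := abs _ _ _ t20 (k1 t t1); have b2 := abs _ _ _ t20 (k2 t t1).
have b3 := abs _ _ _ t20 (k3 t t1); have b4 := abs _ _ _ t20 (k4 t t1).
split.
  apply: le_trans (lerD a1 a2) _; rewrite -mulrDl ler_wpM2r // -[leRHS]addrA lerDl.
  by rewrite !addr_ge0.
apply: le_trans (lerD (tri _ _ (g + rscal t X)) (tri _ _ (J + rscal t Y))) _.
apply: le_trans (lerD (lerD b1 b2) (lerD b3 b4)) _.
by rewrite -!mulrDl ler_wpM2r // -[leRHS]addrA lerDr addr_ge0.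
Qed.

Hypotheses (sF : smooth_on_M F) (invF : UUinvariant F).
Variables (g J nF dF : Mx).
Hypotheses (gu : g \in unitmx) (hnF : is_nabla1 F g J nF) (hdF : is_d2 F g J dF).

(** By cyclicity of the trace the pairing is the derivative of F at g in the direction g A, which is
    tangent to the orbit of right multiplication by U(n). *)
Lemma nabla1_right_invariant (A : Mx) : adjm A = - A -> ip (invmx g *m nF *m g) A = 0.
Proof.
move=> hA; rewrite !ip_mulmx ipC ip_mulmx -mulmxA.
have [u [uu uj]] := exists_unitary_curve hA.
set X := g *m (A *m invmx g).
(* The action is g eta^-1, so the orbit has velocity - g A; exp(- t X) g has the same jet because X
   g = g A. *)
have j1 : jet1 (fun t => expm (rscal t (- X)) *m g) g (- (g *m A)).
  apply: jet1_eq (jet1M (jet1_expm (- X)) (jet1_cst g)) _ _; first exact: mul1mx.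
  by rewrite mulmx0 add0r mulNmx /X -!mulmxA mulVmx // mulmx1.
have j2 : jet1 (fun t => g *m adjm (u t)) g (- (g *m A)).
  apply: jet1_eq (jet1M (jet1_cst g) (jet1_adjm uj)) _ _.
    by rewrite adjm1 mulmx1.
  by rewrite mul0mx addr0 hA mulmxN.
have h1 := is_derive_jet sF gu j1 j2 (jet1_cst J) (jet1_cst J) (hnF (- X)).
have h2 : is_derive (0 : R) (1 : R) (fun t => F (g *m adjm (u t)) J) 0.
  rewrite (_ : (fun t => _) = fun=> F g J); first exact: is_derive_cst.
  apply/funext => t; have [_ <-] := unitary_unitmx (uu t).
  exact: (invF J (uu t) gu).1.
have := is_derive_unique h1 h2; rewrite ipNr => /eqP; rewrite oppr_eq0 => /eqP.
by [].
Qed.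

(** Invariance reads F(u g, J) = F(g, u^-1 J u). Differentiating at u = 1 along an anti-Hermitian A
    gives ip nF A = ip dF [J, A] = ip [dF, J] A. *)
Lemma nabla1_left_invariant : pplus nF = pplus (lie dF J).
Proof.
apply/eqP; rewrite -subr_eq0; apply/eqP.
have -> : pplus nF - pplus (lie dF J) = pplus (nF - lie dF J).
  rewrite /pplus !half_rscal adjmD adjmN -[- rscal _ _]scalerN -rscalDr.
  by congr rscal; rewrite !opprD !opprK addrACA.
apply: pplus_eq0 => A hA; rewrite ipBl ip_lie.
have [u [uu uj]] := exists_unitary_curve hA.
apply/eqP; rewrite subr_eq0; apply/eqP.
have j1 : jet1 (fun t => expm (rscal t A) *m g) g (A *m g).
  apply: jet1_eq (jet1M (jet1_expm A) (jet1_cst g)) _ _; first exact: mul1mx.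
  by rewrite mulmx0 add0r.
have j2 : jet1 (fun t => u t *m g) g (A *m g).
  apply: jet1_eq (jet1M uj (jet1_cst g)) _ _; first exact: mul1mx.
  by rewrite mulmx0 add0r.
have j3 : jet1 (fun t => adjm (u t) *m J *m u t) J (lie J A).
  apply: jet1_eq (jet1M (jet1M (jet1_adjm uj) (jet1_cst J)) uj) _ _.
    by rewrite adjm1 mul1mx mulmx1.
  by rewrite adjm1 mul1mx mulmx1 mulmx0 add0r hA mulNmx.
have h1 := is_derive_jet sF gu j1 j2 (jet1_cst J) (jet1_cst J) (hnF A).
have h2 := is_derive_jet sF gu (jet1_cst g) (jet1_cst g) (jet1_line J (lie J A)) j3
  (hdF (lie J A)).
apply: is_derive_unique h1 _; rewrite (_ : (fun t => _) =
  fun t => F g (adjm (u t) *m J *m u t)) //.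
apply/funext => t; have [_ ut] := unitary_unitmx (uu t).
have := (invF (adjm (u t) *m J *m u t) (uu t) gu).2; rewrite ut => <-.
have hu := uu t; rewrite /unitary in hu.
by rewrite -!mulmxA hu mulmx1 mulmxA hu mul1mx.
Qed.

End Gradients.

(** * Conjugation by e^q and the decomposition of the gradient *)

Section Diagonal.
Variables (R : realType) (n : nat).
Local Notation Mx := 'M[R[i]]_n.+1.
Variable q : Mx.
Hypothesis regq : regular q.

Let e (i : 'I_n.+1) : R := expR (reC (q i i)).

Lemma expm_diag_mx : expm q = diag_mx (\row_i (e i)%:C%C).
Proof.
rewrite (expm_diag regq.1); apply/matrixP => i j; rewrite !mxE.
by case: eqVneq => [->|]; rewrite ?mulr1n ?mulr0n.
Qed.

Lemma expm_diag_unit : expm q \in unitmx.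
Proof.
rewrite expm_diag_mx unitmxE det_diag unitfE.
apply/prodf_neq0 => i _; rewrite mxE.
by apply/eqP => /(congr1 (@reC R)) /eqP; rewrite gt_eqF // expR_gt0.
Qed.

(** Makes the variation of q a left translation of e^q, so that the reduced gradient can be compared
    with [is_nabla1]. *)
Lemma expm_translate (X : Mx) (t : R) : G0minus X ->
  expm (q + rscal t X) = expm (rscal t X) *m expm q.
Proof.
move=> [X0 Xr].
have G0t : G0minus (rscal t X).
  split=> [i j ij|i]; first by rewrite mxE X0 // mulr0.
  by rewrite mxE imM Xr mulr0 add0r mul0r.
have [[q0 qr] _] := regq.
have G0q : G0minus (q + rscal t X).
  split=> [i j ij|i]; first by rewrite mxE q0 // G0t.1 // addr0.
  by rewrite mxE imD qr G0t.2 addr0.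
rewrite (expm_diag G0q) (expm_diag G0t) expm_diag_mx mul_mx_diag.
apply/matrixP => i j; rewrite !mxE; case: eqVneq => [->|]; last by rewrite mul0r.
by rewrite -rmorphM reD expRD mulrC.
Qed.

Lemma regular_neq i j : i != j -> reC (q i i) - reC (q j j) != 0.
Proof.
move=> ij; rewrite subr_eq0; have [_ h] := regq.
have [lij|lji|/val_inj eij] := ltngtP i j.
- by rewrite gt_eqF // h.
- by rewrite lt_eqF // h.
- by rewrite eij eqxx in ij.
Qed.

(** The fraction is expanded by e^(x+y); squares of the eigenvalues of e^q are what arises in
    [hermitian_conj_expm]. *)
Lemma coth_exp (x y : R) : x - y != 0 ->
  coth (x - y) = (expR x ^+ 2 + expR y ^+ 2) / (expR x ^+ 2 - expR y ^+ 2).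
Proof.
move=> xy; rewrite /coth opprB !expRD !expRN.
have ex := expR_gt0 x; have ey := expR_gt0 y.
have exy : expR x != expR y.
  by apply: contra_neq xy => /expR_inj ->; rewrite subrr.
have d : expR x ^+ 2 - expR y ^+ 2 != 0.
  by rewrite subr_sqr mulf_neq0 ?subr_eq0 // gt_eqF // addr_gt0.
by field; rewrite d !gt_eqF.
Qed.

Lemma pplusE (X : Mx) i j : pplus X i j = 2%:R^-1 * (X i j - (X j i)^*%C).
Proof. by rewrite !mxE. Qed.

Lemma pminusE (X : Mx) i j : pminus X i j = 2%:R^-1 * (X i j + (X j i)^*%C).
Proof. by rewrite !mxE. Qed.

(* With N = P + M, Hermiticity of e^(-q) N e^q means P (e^d + e^(-d)) = M (e^d - e^(-d))
   entrywise, where d = q_i - q_j. *)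
Lemma hermitian_conj_expm (N : Mx) :
  (forall A, adjm A = - A -> ip (invmx (expm q) *m N *m expm q) A = 0) ->
  (forall i j, i != j ->
     pminus N i j = (coth (reC (q i i) - reC (q j j)))%:C%C * pplus N i j) /\
  (forall i, N i i = (N i i)^*%C).
Proof.
move=> /pplus_eq0; set W := _ *m _ *m _ => W0.
have hW : adjm W = W by rewrite (pplus_pminus W) W0 add0r adjm_pminus.
have NW : N *m expm q = expm q *m W.
  by rewrite /W !mulmxA mulmxV ?expm_diag_unit // mul1mx.
have ent i j : N i j * (e j)%:C%C = (e i)%:C%C * W i j.
  by have := congr1 (fun A : Mx => A i j) NW; rewrite expm_diag_mx mul_mx_diag mul_diag_mx !mxE.
have conjent i j : (N j i)^*%C * (e i)%:C%C = (e j)%:C%C * W i j.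
  have := congr1 (@conjc R) (ent j i); rewrite !rmorphM /=.
  by rewrite -[(W j i)^*%C]adjmE hW oppr0.
(* Multiplying [ent] by e_j and [conjent] by e_i eliminates W_ij. *)
have rel i j : N i j * (e j ^+ 2)%:C%C = (N j i)^*%C * (e i ^+ 2)%:C%C.
  rewrite !expr2 !rmorphM !mulrA ent conjent; ring.
split=> [i j ij|i]; last first.
  have := rel i i; apply: mulIf.
  by apply/eqP => /(congr1 (@reC R)) /eqP; rewrite gt_eqF // exprn_gt0 // expR_gt0.
have qij := regular_neq ij.
rewrite (coth_exp qij) pplusE pminusE.
rewrite fmorph_div rmorphB rmorphD; move: (rel i j).
have : (e i ^+ 2)%:C%C - (e j ^+ 2)%:C%C != 0 :> R[i].
  rewrite subr_eq0; apply: contra_neq qij => /complexI /eqP.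
  by rewrite eqrXn2 ?expR_ge0 // => /eqP /expR_inj ->; rewrite subrr.
rewrite /e; set x := (_ ^+ 2)%:C%C; set y := (_ ^+ 2)%:C%C.
set a := N i j; set b := (N j i)^*%C => xy h.
(* The relation a y = b x, with x = e_i^2 and y = e_j^2, rewritten in a + b and a - b. *)
have hab : (a + b) * (x - y) = (a - b) * (x + y).
  apply/eqP; rewrite -subr_eq0 (_ : _ - _ = 2 * (b * x - a * y)); last by ring.
  by rewrite h subrr mulr0.
by rewrite -[a + b](mulfK xy) hab; ring.
Qed.

Lemma ip_delta (X : Mx) i : ip X (delta_mx i i) = reC (X i i).
Proof.
rewrite /ip /mxtrace (bigD1 i) //= mxE (bigD1 i) //= mxE !eqxx mulr1.
rewrite big1 => [|j /negPf ji]; last by rewrite mxE ji mulr0.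
rewrite addr0 big1 ?addr0 // => j /negPf ji.
by rewrite mxE big1 // => k _; rewrite mxE ji andbF mulr0.
Qed.

Section Decomposition.
Variables (F : Mx -> Mx -> R) (J nF dF nf : Mx).
Hypotheses (sF : smooth_on_M F) (invF : UUinvariant F).
Hypotheses (hnF : is_nabla1 F (expm q) J nF) (hdF : is_d2 F (expm q) J dF).
Hypothesis hnf : is_nabla1_red (restr F) q J nf.

Lemma nabla1_decomposition :
  nF = pplus (lie dF J) + Rq q (pplus (lie dF J)) + nf.
Proof.
rewrite -(nabla1_left_invariant sF invF expm_diag_unit hnF hdF).
have [hoff hreal] :=
  hermitian_conj_expm (nabla1_right_invariant sF invF expm_diag_unit hnF).
have [[nf0 nfr] nfd] := hnf.
(* Pairing with the real diagonal matrix E_ii reads off the real part of a diagonal entry. *)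
have hdiag i : reC (nF i i) = reC (nf i i).
  have G0d : G0minus (delta_mx i i : Mx).
    split=> [k l kl|k]; rewrite !mxE; last by case: (_ && _).
    by move: kl; case: (eqVneq l i) => [->|_]; case: (eqVneq k i).
  rewrite -!ip_delta; apply: is_derive_unique (hnF _) _.
  rewrite (_ : (fun t => _) = fun t => restr F (q + rscal t (delta_mx i i)) J).
    exact: nfd.
  by apply/funext => t; rewrite /restr expm_translate.
apply/matrixP => i j.
have -> : nF i j = pplus nF i j + pminus nF i j by rewrite {1}(pplus_pminus nF) mxE.
rewrite [RHS]mxE [in RHS]mxE [Rq _ _ i j]mxE.
(* Off the diagonal nf vanishes and [hoff] applies. On it [Rq] vanishes by definition and nF is
   real, so only nf remains. *)
have [<-|ij] := eqVneq i j; last by rewrite -hoff // nf0 // addr0.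
have half2 (z : R[i]) : 2%:R^-1 * (z + z) = z by field.
rewrite pplusE pminusE -hreal subrr mulr0 !add0r half2.
apply: complex_eqP; rewrite ?nfr //.
by have := congr1 (@imC R) (hreal i); case: (nF i i) => a b; rewrite /imC /= => h; lra.
Qed.
End Decomposition.

End Diagonal.

(** * The reduced bracket *)

Section ReducedBracket.
Variables (R : realType) (n : nat).
Local Notation Mx := 'M[R[i]]_n.+1.
Variable q : Mx.
Implicit Types X Y Z : Mx.

Lemma cothN (x : R) : coth (- x) = - coth x.
Proof. by rewrite /coth opprK addrC -mulrN -invrN opprB. Qed.

Lemma RqN X : Rq q (- X) = - Rq q X.
Proof.
by apply/matrixP => i j; rewrite !mxE; case: eqVneq; rewrite ?oppr0 // mulrN.
Qed.

(** Transposition turns q_i - q_j into its negative and coth is odd. Hence R(q) exchanges Hermitian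
    and anti-Hermitian matrices. *)
Lemma adjm_Rq X : adjm (Rq q X) = - Rq q (adjm X).
Proof.
apply/matrixP => i j; rewrite adjmE !mxE eq_sym.
case: eqVneq => _; first by rewrite conjc0 oppr0.
by rewrite rmorphM -opprB cothN [X in X * _]conjc_real rmorphN mulNr.
Qed.

(** Oddness of coth again, as the trace pairs entry (i, j) with entry (j, i). *)
Lemma ip_Rq X Y : ip (Rq q X) Y = - ip X (Rq q Y).
Proof.
rewrite /ip /mxtrace !re_sum -sumrN; apply: eq_bigr => i _.
rewrite !mxE !re_sum -sumrN; apply: eq_bigr => j _; rewrite !mxE eq_sym.
case: eqVneq => _; first by rewrite mul0r mulr0 oppr0.
by rewrite -(opprB (reC (q j j))) cothN rmorphN !mulNr reN; congr (- reC _); ring.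
Qed.

Lemma ip_G0minus D X : G0minus D -> ip D X = ip D (pminus0 X).
Proof.
move=> [D0 Dr]; have hD : adjm D = D.
  apply/matrixP => i j; rewrite adjmE.
  have [->|ij] := eqVneq i j; last by rewrite !D0 ?conjc0 // eq_sym.
  apply: complex_eqP; rewrite ?Dr //; last first.
    by move: (Dr j); case: (D j j) => a b; rewrite /imC /= => ->; rewrite oppr0.
  by case: (D j j).
rewrite ipC -(ip_pminus X hD) ipC /ip; congr reC; apply: eq_bigr => i _.
rewrite !mxE; apply: eq_bigr => j _; rewrite [pminus0 X j i]mxE.
by case: eqVneq => [//|ji]; rewrite D0 ?mul0r // eq_sym.
Qed.

Lemma antiherm_lie_pplus X Y : adjm (lie (pplus X) (pplus Y)) = - lie (pplus X) (pplus Y).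
Proof. by rewrite adjm_lie !adjm_pplus lieNl lieC lieNl opprK lieC opprK. Qed.

Lemma antiherm_lie_pminus X Y : adjm (lie (pminus X) (pminus Y)) = - lie (pminus X) (pminus Y).
Proof. by rewrite adjm_lie !adjm_pminus lieC. Qed.

(** P is anti-Hermitian, R(q) P Hermitian and D real diagonal, so each sees only the part of b of
    its own type. *)
Lemma ip_decomposition (b P D : Mx) : adjm P = - P -> G0minus D ->
  ip (P + Rq q P + D) b = ip P (pplus b) + ip (Rq q P) (pminus b) + ip D (pminus0 b).
Proof.
move=> hP hD; rewrite !ipDl (ip_G0minus b hD); congr (_ + _ + _).
  by rewrite ipC (ipC P) ip_pplus.
rewrite ipC [RHS]ipC ip_pminus //.
by rewrite adjm_Rq hP RqN opprK.
Qed.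

Lemma antihermB X Y : adjm X = - X -> adjm Y = - Y -> adjm (X - Y) = - (X - Y).
Proof. by move=> hX hY; rewrite adjmD adjmN hX hY opprD. Qed.

(** Bilinear expansion: the mixed terms cancel, and [ap, bp] keeps the coefficient 1 - 2 = -1. *)
Lemma ip_lie_expand (J ap am bp bm : Mx) :
  - ip J (lie (ap + am) bp) - ip J (lie ap (bp + bm)) + ip J (lie (ap + am) (bp + bm)) =
  ip J (lie am bm - lie ap bp).
Proof.
have Dl X Y Z : ip J (lie (X + Y) Z) = ip J (lie X Z) + ip J (lie Y Z).
  by rewrite lieDl ipDr.
have Dr X Y Z : ip J (lie Z (X + Y)) = ip J (lie Z X) + ip J (lie Z Y).
  by rewrite lieDr ipDr.
rewrite [RHS]ipBr !Dl !Dr.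
move: (ip J (lie ap bp)) (ip J (lie ap bm)) (ip J (lie am bp)) (ip J (lie am bm)).
by move=> x y z w; ring.
Qed.

Lemma ip_pplus_lie (J X Y : Mx) :
  ip (pplus (lie X J)) (pplus Y) = - ip J (lie X (pplus Y)).
Proof. by rewrite ip_pplus ?adjm_pplus // lieC ipNl ip_lie. Qed.

(** Invariance of [ip] turns every term into [ip J] of a commutator. The combined commutator is
    anti-Hermitian, so only [pplus J] contributes. *)
Lemma bracket_terms (a b J : Mx) :
  ip (pplus (lie a J)) (pplus b) - ip (pplus (lie b J)) (pplus a) + ip J (lie a b) =
  ip (pplus J) (lie (pminus a) (pminus b) - lie (pplus a) (pplus b)).
Proof.
rewrite [RHS]ip_pplus; last first.
  by apply: antihermB; [exact: antiherm_lie_pminus|exact: antiherm_lie_pplus].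
rewrite -ip_lie_expand -!pplus_pminus; congr (_ - _ + _); first exact: ip_pplus_lie.
by rewrite ip_pplus_lie (lieC b) ipNr opprK.
Qed.

End ReducedBracket.

(** * Gradients of the trace powers *)

Section TracePowers.
Variables (R : realType) (n : nat).
Local Notation Mx := 'M[R[i]]_n.+1.
Variable J : Mx.

(** Induction with the Leibniz rule, the commutator with Y being a derivation. *)
Lemma jet1_exp_lie (Y : Mx) k :
  jet1 (fun t => (J + rscal t (lie Y J)) ^+ k) (J ^+ k) (lie Y (J ^+ k)).
Proof.
elim: k => [|k ih].
  apply: jet1_eq (jet1_cst 1%:M) _ _; first by rewrite expr0.
  by rewrite expr0 /lie mulmx1 mul1mx subrr.
rewrite (_ : (fun t => _) = fun t => (J + rscal t (lie Y J)) ^+ k *m (J + rscal t (lie Y J))).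
  apply: jet1_eq (jet1M ih (jet1_line J (lie Y J))) _ _; first by rewrite exprSr.
  rewrite exprSr /lie mulmxBr mulmxBl !mulmxA addrC subrKA //.
by apply/funext => t; rewrite exprSr.
Qed.

Lemma norm1c_tr (X : Mx) : norm1c (\tr X) <= norm1 X.
Proof.
apply: (@le_trans _ _ (\sum_i norm1c (X i i))).
  rewrite /mxtrace; elim/big_ind2: _ => [|x1 x2 y1 y2 h1 h2|//]; first by rewrite norm1c0.
  exact: le_trans (norm1cD _ _) (lerD h1 h2).
apply: ler_sum => i _; rewrite (bigD1 i) //= lerDl.
by apply: sumr_ge0 => j _; exact: norm1c_ge0.
Qed.

(* The directions [Y, J] are tangent to the conjugation orbit of J, on which the trace
   of J^k is constant. *)
Lemma d2_tr_pow_commute (k : nat) (phi : R[i] -> R) (c : R) (H : Mx -> Mx -> R) (g dH : Mx) :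
  (forall z w, `|phi z - phi w| <= c * norm1c (z - w)) ->
  (forall g J, H g J = phi (\tr (J ^+ k))) ->
  is_d2 H g J dH -> lie dH J = 0.
Proof.
move=> hphi hH hd; rewrite lieC; apply/eqP; rewrite oppr_eq0; apply/eqP.
(* Pairing with Y turns the claim into the vanishing of the derivative of H along [Y, J]. *)
apply: ip_nondegenerate => Y; rewrite ip0l ipC -ip_lie ipC.
have c0 : 0 <= c.
  have := hphi 1 0; rewrite subr0 /norm1c /reC /imC /= normr1 normr0 addr0 mulr1.
  exact: le_trans.
apply: is_derive_unique (hd (lie Y J)) _.
have [K hK] := jet1_exp_lie Y k.
apply: (is_derive_close (f := fun=> H g J) (K := c * K) ltr01) => t t1.
rewrite !hH; apply: le_trans (hphi _ _) _; rewrite -mulrA ler_wpM2l //.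
apply: le_trans (hK t t1).
have trk : \tr (J ^+ k + rscal t (lie Y (J ^+ k))) = \tr (J ^+ k).
  rewrite mxtraceD mxtraceZ (_ : \tr (lie _ _) = 0) ?mulr0 ?addr0 //.
  by rewrite /lie raddfB /= mxtrace_mulC subrr.
rewrite -trk -(raddfB (@mxtrace R[i] n.+1)); exact: norm1c_tr.
Qed.

Lemma is_d2_Hk_commute k (g dH : Mx) :
  is_d2 (@Hk R n k) g J dH \/ is_d2 (@tHk R n k) g J dH -> lie dH J = 0.
Proof.
have k0 : 0 <= (k%:R)^-1 :> R by rewrite invr_ge0.
case.
  apply: (@d2_tr_pow_commute k (fun z => k%:R^-1 * reC z) k%:R^-1) => // z w.
  by rewrite -mulrBr normrM ger0_norm // ler_wpM2l // -reN -reD norm1c_re.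
apply: (@d2_tr_pow_commute k (fun z => k%:R^-1 * imC z) k%:R^-1) => // z w.
by rewrite -mulrBr normrM ger0_norm // ler_wpM2l // -imN -imD norm1c_im.
Qed.

Lemma nabla1_cst (H : Mx -> Mx -> R) (g nH : Mx) :
  (forall g g' J, H g J = H g' J) -> is_nabla1 H g J nH -> nH = 0.
Proof.
move=> hH hn; apply: ip_nondegenerate => X; rewrite ip0l.
apply: is_derive_unique (hn X) _.
rewrite (_ : (fun t => _) = fun=> H g J); first exact: is_derive_cst.
by apply/funext => t; exact: hH.
Qed.

End TracePowers.

Theorem theorem3p4 (R : realType) (n : nat) (F H : 'M[R[i]]_n.+1 -> 'M[R[i]]_n.+1 -> R) :
  smooth_on_M F -> UUinvariant F -> smooth_on_M H -> UUinvariant H ->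
  forall q J : 'M[R[i]]_n.+1, regular q ->
  forall nF dF nH dH nf df nh dh : 'M[R[i]]_n.+1,
    (* gradients of F, H at (e^q, J) in M *)
    is_nabla1 F (expm q) J nF -> is_d2 F (expm q) J dF ->
    is_nabla1 H (expm q) J nH -> is_d2 H (expm q) J dH ->
    (* gradients of f = F o iota, h = H o iota at (e^q, J) in M_0^reg *)
    is_nabla1_red (restr F) q J nf -> is_d2_red (restr F) q J df ->
    is_nabla1_red (restr H) q J nh -> is_d2_red (restr H) q J dh ->
    bracket1 J nF dF nH dH =
      ip nf (pminus0 dh) - ip nh (pminus0 df)
      + ip (Rq q (pplus (lie df J))) (pminus dh)
      - ip (Rq q (pplus (lie dh J))) (pminus df)
      + ip (pplus J) (lie (pminus df) (pminus dh) - lie (pplus df) (pplus dh))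
    /\
    ((exists k : nat, (0 < k)%N /\ (H = @Hk R n k \/ H = @tHk R n k)) ->
     bracket1 J nF dF nH dH =
       ip nf (pminus0 dh) + ip df (lie (Rq q (pminus dh) - pplus dh) J)).
Proof.
move=> sF iF sH iH q J regq nF dF nH dH nf df nh dh hnF hdF hnH hdH hnf hdf hnh hdh.
(* Both gradients differentiate along the same lines in J at fixed e^q. *)
have -> : df = dF.
  by apply: ip_nondegenerate => X; exact: is_derive_unique (hdf X) (hdF X).
have -> : dh = dH.
  by apply: ip_nondegenerate => X; exact: is_derive_unique (hdh X) (hdH X).
have eF := nabla1_decomposition regq sF iF hnF hdF hnf.
have eH := nabla1_decomposition regq sH iH hnH hdH hnh.
have [G0f _] := hnf; have [G0h _] := hnh.
have ipF := ip_decomposition q dH (adjm_pplus (lie dF J)) G0f.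
have ipH := ip_decomposition q dF (adjm_pplus (lie dH J)) G0h.
rewrite -eF in ipF; rewrite -eH in ipH; rewrite /bracket1 ipF.
split=> [|[k [_ hk]]].
  (* Here c, c' are the diagonal terms and b, b' the R(q) terms; a, a' and d form the left side of
     [bracket_terms]. *)
  have arith (a b c a' b' c' d : R) :
    a + b + c - (a' + b' + c') + d = c - c' + b - b' + (a - a' + d) by ring.
  by rewrite ipH -bracket_terms; exact: arith.
have nH0 : nH = 0 by apply: nabla1_cst hnH => g g' X; case: hk => ->.
have comm : lie dH J = 0.
  by apply: (@is_d2_Hk_commute _ _ _ k (expm q)); case: hk => <-; [left|right].
(* By invariance this is a pairing of dF with [dH, J], which vanishes. *)
have -> : ip J (lie dF dH) = 0.
  by rewrite -ip_lie ipC -ip_lie comm ip0l.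
have ad X : adjm X = - X -> ip (pplus (lie dF J)) X = - ip dF (lie X J).
  by move=> hX; rewrite (ip_pplus _ hX) ip_lie lieC ipNr.
have hR : adjm (Rq q (pminus dH)) = - Rq q (pminus dH) by rewrite adjm_Rq adjm_pminus.
rewrite nH0 ip0l subr0 addr0 ip_Rq (ad _ hR) (ad _ (adjm_pplus dH)).
rewrite (lieDl _ _ J) (lieNl _ J) (ipBr dF) opprK addrC; congr (_ + _).
exact: addrC.
Qed.
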